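(* Let $X=\mathcal{S}(\mathbb{R}^n)$ or $\mathcal{V}(\mathbb{R}^n)$, let $K\in\mathcal{K}^n_{(o)}$, and let $T:X\to X$ be a $K$-smoothing rearrangement. (i) If $K$ is $o$-symmetric (i.e. $K=-K$), then $T$ reduces the $K$-modulus of continuity of each $f\in X$, i.e. $\omega_{K,d}(Tf)\le\omega_{K,d}(f)$ for all $d>0$ and $f\in X$. (ii) If $d>0$, $f\in X$, and $rB^n\subset K\subset RB^n$ for $0<r\le R$, then $\omega_{dr}(Tf)\le\omega_{dR}(f)$.
   Context: Throughout $n\ge 2$, $\mathcal{H}^n$ is $n$-dimensional Hausdorff (Lebesgue) measure in $\mathbb{R}^n$, $\|\cdot\|$ is the Euclidean norm, and $B^n$ is the closed unit ball. ''Essentially'' means up to a set of $\mathcal{H}^n$-measure zero. $\mathcal{M}^n$ is the class of measurable subsets of $\mathbb{R}^n$ and $\mathcal{L}^n$ the class of measurable sets of finite measure. $\mathcal{K}^n_{(o)}$ is the class of compact convex subsets of $\mathbb{R}^n$ containing the origin in their interiors. $\mathcal{S}(\mathbb{R}^n)$ is the set of real-valued measurable functions $f$ on $\mathbb{R}^n$ with $\mathcal{H}^n(\{x:f(x)>t\})<\infty$ for all $t>\operatorname{ess\,inf} f$; $\mathcal{V}(\mathbb{R}^n)$ is the set of nonnegative real-valued measurable functions $f$ with $\mathcal{H}^n(\{x:f(x)>t\})<\infty$ for all $t>0$. A rearrangement $T:X\to X$ is a map that is equimeasurable, i.e. $\mathcal{H}^n(\{x:Tf(x)>t\})=\mathcal{H}^n(\{x:f(x)>t\})$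 for all $t\in\mathbb{R}$ and $f\in X$, and monotonic, i.e. for $f,g\in X$, $f\le g$ essentially implies $Tf\le Tg$ essentially. The gauge function of $K$ is $\|x\|_K=\inf\{\lambda\ge0:x\in\lambda K\}$. For $d>0$, $\omega_{K,d}(f)=\operatorname{ess\,sup}_{\|x-y\|_K\le d}|f(x)-f(y)|$, the essential supremum over $\{(x,y)\in\mathbb{R}^n\times\mathbb{R}^n:\|x-y\|_K\le d\}$ with respect to $2n$-dimensional Lebesgue measure, and $\omega_d(f)=\omega_{B^n,d}(f)=\operatorname{ess\,sup}_{\|x-y\|\le d}|f(x)-f(y)|$. For $A\in\mathcal{M}^n$, $A^*$ denotes the set of Lebesgue density points of $A$ (points of $\mathbb{R}^n$ where $A$ has density $1$). For $A\in\mathcal{L}^n$ put $\diamondsuit_TA=\{x:T1_A(x)=1\}$ and $\diamondsuit_T^*A=(\diamondsuit_TA)^*$. $T$ is $K$-smoothing if for each $d>0$ and each bounded $A\in\mathcal{M}^n$, $(\diamondsuit_T^*A)+dK\subset\diamondsuit_T^*(A+dK)$, essentially (Minkowski sums). *)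

(* Defs.v *)
From HB Require Import structures.
From mathcomp Require Import all_boot all_order all_algebra.
From mathcomp Require Import all_classical all_reals all_analysis.
From mathcomp Require Import ess_sup_inf.

Set Implicit Arguments.
Unset Strict Implicit.
Unset Printing Implicit Defensive.
Import Order.TTheory GRing.Theory Num.Theory.
Import numFieldNormedType.Exports.

Local Open Scope classical_set_scope.
Local Open Scope ring_scope.

(* Points of R^n are row vectors 'rV[R]_n.  The topology, compactness and
   boundedness notions are the library ones (their sup norm is equivalent to the
   Euclidean norm); every metric notion below uses the Euclidean norm [enorm]. *)

Section lebesgue_outer_measure.
Context {R : realType} (n : nat).

(* [None] is the empty box; it is needed only to cover set0 when n = 0, where
   every [Some] box is a point of volume 1. *)
Definition box (c : option ('rV[R]_n * 'rV[R]_n)) : set 'rV[R]_n :=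
  if c is Some (a, b) then
    [set x | forall i, a ord0 i <= x ord0 i <= b ord0 i]
  else set0.

Definition box_volume (c : option ('rV[R]_n * 'rV[R]_n)) : \bar R :=
  if c is Some (a, b) then (\prod_i Num.max 0 (b ord0 i - a ord0 i))%:E
  else 0%E.

Local Open Scope ereal_scope.

Definition lebesgue_outer (A : set 'rV[R]_n) : \bar R :=
  ereal_inf [set \sum_(k <oo) box_volume (c k)
            | c in [set c | A `<=` \bigcup_k box (c k)]].

Lemma box_volume_ge0 c : 0 <= box_volume c.
Proof.
case: c => [[a b]|] //=; rewrite lee_fin; apply: prodr_ge0 => i _.
by rewrite le_max lexx.
Qed.

Let le_lebesgue_outer : {homo lebesgue_outer : A B / A `<=` B >-> A <= B}.
Proof.
move=> A B AB; apply/ereal_inf_le_tmp => x [c Bc <-{x}]; exists c => //=.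
exact: subset_trans AB Bc.
Qed.

Let lebesgue_outer_ge0 A : 0 <= lebesgue_outer A.
Proof.
apply: le_ereal_inf_tmp => x [c _ <-{x}].
by apply: nneseries_ge0 => k _ _; exact: box_volume_ge0.
Qed.

Let lebesgue_outer0 : lebesgue_outer set0 = 0.
Proof.
apply/eqP; rewrite eq_le lebesgue_outer_ge0 andbT.
by apply: ereal_inf_lbound; exists (fun=> None) => //=; rewrite eseries0.
Qed.

Let lebesgue_outer_sigma_subadditive : sigma_subadditive lebesgue_outer.
Proof.
move=> A; have [[i ioo]|] := pselect (exists i, lebesgue_outer (A i) = +oo).
  rewrite (eseries_pinfty _ _ ioo) ?leey// => k _.
  by rewrite -ltNye (lt_le_trans _ (lebesgue_outer_ge0 _)).
rewrite -forallNE => Aoo.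
suff add2e (e : {posnum R}) :
    lebesgue_outer (\bigcup_k A k) <=
    \sum_(i <oo) lebesgue_outer (A i) + e%:num%:E.
  by apply/lee_addgt0Pr => _/posnumP[].
rewrite (le_trans _ (epsilon_trick _ _ _))//.
pose P k (c : nat -> option ('rV[R]_n * 'rV[R]_n)) :=
  A k `<=` \bigcup_j box (c j) /\
  \sum_(j <oo) box_volume (c j) <=
    lebesgue_outer (A k) + (e%:num / (2 ^ k.+1)%:R)%:E.
have [G PG] : {G & forall k, P k (G k)}.
  apply: (@choice _ _ P) => k; rewrite /P /lebesgue_outer.
  set S := (X in ereal_inf X); move infS : (ereal_inf S) => iS.
  case: iS infS => [r Sr|Soo|Soo].
  - have en1 : (0 < e%:num / (2 ^ k.+1)%:R)%R by [].
    have /(lb_ereal_inf_adherent en1) : ereal_inf S \is a fin_num by rewrite Sr.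
    move=> [x [c Ac cx] xS].
    by exists c; split => //; rewrite cx -Sr; exact/ltW.
  - by have := Aoo k; rewrite /lebesgue_outer Soo.
  - by have := lebesgue_outer_ge0 (A k); rewrite /lebesgue_outer -/S Soo.
pose vol := box_volume \o uncurry G.
have vol0 x : 0 <= vol x by exact: box_volume_ge0.
apply: (@le_trans _ _ (\esum_(i in setT) vol i)).
  apply: ereal_inf_lbound => /=.
  have /card_esym/ppcard_eqP[f] := card_nat2.
  exists (uncurry G \o f).
    move=> t [i _ /(PG i).1[j _ Bijt]].
    by exists (f^-1%FUN (i, j)) => //=; rewrite invK ?inE.
  rewrite -(esum_pred_image vol _ xpredT) ?[fun=> _]set_true//.
  by rewrite image_eq.
rewrite (_ : esum _ _ = \sum_(i <oo) \sum_(j <oo) box_volume (G i j)); last first.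
  pose J : nat -> set (nat * nat) := fun i => [set (i, j) | j in setT].
  rewrite (_ : setT = \bigcup_k J k); last first.
    by rewrite predeqE => -[a b]; split => // _; exists a => //; exists b.
  rewrite esum_bigcupT /=; last 2 first.
    - apply/trivIsetP => i j _ _ ij.
      rewrite predeqE => -[k m] /=; split => //= -[] [_] _ [<-{k} _].
      by move=> [m' _] [] /esym/eqP; rewrite (negbTE ij).
    - by [].
  rewrite -(image_id [set: nat]) -fun_true esum_pred_image//; last first.
    by move=> k _; exact: esum_ge0.
  apply: eq_eseriesr => /= j _.
  rewrite -(esum_pred_image vol (pair j) predT)//=; last first.
    by move=> ? ? _ _; exact: (@can_inj _ _ _ snd).
  by congr esum; rewrite predeqE => -[a b]; split; move=> [i _ <-]; exists i.
apply: lee_nneseries => [i _ _|i _]; last exact: (PG i).2.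
by apply: nneseries_ge0 => j _ _; exact: box_volume_ge0.
Qed.

HB.instance Definition _ := isOuterMeasure.Build R 'rV[R]_n lebesgue_outer
  lebesgue_outer0 lebesgue_outer_ge0 le_lebesgue_outer
  lebesgue_outer_sigma_subadditive.

End lebesgue_outer_measure.

(* R^n with the sigma-algebra of all Lebesgue measurable (i.e. Caratheodory
   measurable for [lebesgue_outer]) sets; convertible to 'rV[R]_n. *)
Notation lebesgueRn R n := (caratheodory_type (@lebesgue_outer R n)).

Section lebesgue.
Context {R : realType} (n : nat).
Local Open Scope ereal_scope.

Definition lebesgue : set (lebesgueRn R n) -> \bar R := @lebesgue_outer R n.

Let lebesgue0 : lebesgue set0 = 0.
Proof. exact: caratheodory_measure0. Qed.

Let lebesgue_ge0 A : 0 <= lebesgue A.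
Proof. exact: caratheodory_measure_ge0. Qed.

Let lebesgue_semi_sigma_additive : semi_sigma_additive lebesgue.
Proof. exact: caratheodory_measure_sigma_additive. Qed.

HB.instance Definition _ := isMeasure.Build _ _ _ lebesgue
  lebesgue0 lebesgue_ge0 lebesgue_semi_sigma_additive.

End lebesgue.
Arguments lebesgue {R} n _.

Section definitions.
Context {R : realType} {n : nat}.
Local Notation Rn := 'rV[R]_n.
Implicit Types (A B K : set Rn) (f g : Rn -> R) (X : set (Rn -> R)).
Implicit Types (T : (Rn -> R) -> (Rn -> R)).

Definition lmeasurable A : Prop := measurable (A : set (lebesgueRn R n)).

Definition lmeasurable_fun f : Prop :=
  measurable_fun (setT : set (lebesgueRn R n)) (f : lebesgueRn R n -> R).

Definition enorm (x : Rn) : R := Num.sqrt (\sum_i x ord0 i ^+ 2).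

Definition eball (x : Rn) (r : R) : set Rn := [set y | enorm (y - x) <= r].

Definition unit_ball : set Rn := eball 0 1.

Definition dilate (l : R) K : set Rn := [set l *: x | x in K].

Definition minkowski_sum A B : set Rn := [set x + y | x in A & y in B].

Definition ess_subset A B : Prop := (lebesgue n).-negligible (A `\` B).

Definition ess_le f g : Prop := {ae lebesgue n, forall x, f x <= g x}.

Definition convex_body_o K : Prop :=
  [/\ compact K, convex_set K & interior K 0].

Definition o_symmetric K : Prop := [set - x | x in K] = K.

Definition spaceS : set (Rn -> R) := [set f | lmeasurable_fun f /\
  forall t : R, (ess_inf (lebesgue n) (fun x => (f x)%:E) < t%:E)%E ->
    (lebesgue n [set x | (f x > t)%R] < +oo)%E].

Definition spaceV : set (Rn -> R) := [set f |
  [/\ lmeasurable_fun f, forall x, 0 <= f x &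
   forall t : R, 0 < t -> (lebesgue n [set x | (f x > t)%R] < +oo)%E]].

(* A map T : X -> X is represented by a total function on functions that
   preserves X; its values outside X are never used. *)
Definition rearrangement X T : Prop :=
  [/\ forall f, X f -> X (T f),
      forall f (t : R), X f ->
        lebesgue n [set x | T f x > t] = lebesgue n [set x | f x > t] &
      forall f g, X f -> X g -> ess_le f g -> ess_le (T f) (T g)].

Definition gauge K (x : Rn) : R := inf [set l : R | 0 <= l /\ dilate l K x].

(* The essential supremum of |f x - f y| over {(x, y) | N (x - y) <= d}, for
   Lebesgue measure on R^(n + n), whose points are identified with pairs
   (x, y) = (lsubmx z, rsubmx z).  The value -oo off that set makes the
   essential supremum over R^(n + n) the one over the set. *)
Definition modulus (N : Rn -> R) (d : R) f : \bar R :=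
  ess_sup (lebesgue (n + n))
    (patch (fun=> -oo%E)
       [set z : 'rV[R]_(n + n) | N (lsubmx z - rsubmx z) <= d]
       (fun z => `|f (lsubmx z) - f (rsubmx z)|%:E)).

Definition omegaK K := modulus (gauge K).

Definition omega := modulus enorm.

Definition density_points A : set Rn := [set x |
  (lebesgue n (A `&` eball x r) * (lebesgue n (eball x r))^-1)%E
    @[r --> 0^'+] --> 1%E].

Definition diamond T A : set Rn := [set x | T \1_A x = 1].

Definition diamond_star T A : set Rn := density_points (diamond T A).

Definition smoothing K T : Prop :=
  forall (d : R) A, 0 < d -> lmeasurable A -> bounded_set A ->
    ess_subset (minkowski_sum (diamond_star T A) (dilate d K))
               (diamond_star T (minkowski_sum A (dilate d K))).

End definitions.

(* Main.v *)
Require Import Defs.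
From HB Require Import structures.
From mathcomp Require Import all_boot all_order all_algebra.
From mathcomp Require Import all_classical all_reals all_analysis.
From mathcomp Require Import ess_sup_inf measurable_realfun.
From mathcomp Require Import ring lra.

(** Equimeasurability and monotonicity make [T] act on superlevel sets as on
    indicator functions: [T 1_B > 0] is essentially contained in [T f > s] as
    soon as [B] is essentially contained in [f > s], and [T 1_B] is essentially
    the indicator of a set as large as [B].

    Let [t + omega(f) < s].  By Fubini almost every point [x] of [f > s] is such
    that [f > t] almost everywhere at gauge distance less than [d] from [x].
    Exhaust these points by compact sets [C].  Since [C] is separable,
    [C + l K] is essentially contained in [f > t] for [l < d], so
    [K]-smoothing puts [diamond* C + l K] essentially inside [T f > t], while
    the sets [diamond* C] exhaust [T f > s] by the Lebesgue density theorem.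
    Hence the pairs [(x, y)] at gauge distance less than [d] with [T f x > s]
    and [T f y < t] lie in [N1 x R^n] or [R^n x N2] for null sets [N1] and
    [N2].  Pairs at distance exactly [d] form a null set, by scaling. *)

Set Implicit Arguments.
Unset Strict Implicit.
Unset Printing Implicit Defensive.
Import Order.TTheory GRing.Theory Num.Theory.
Import numFieldNormedType.Exports.

Local Open Scope classical_set_scope.
Local Open Scope ring_scope.

(** * Lebesgue outer measure *)

(** The obstacle is that everything is known only up to null sets, while [C + l K] is an uncountable
    union of translates. The gap between [l] and [d] leaves room to replace the points of [C] by
    countably many of them; compactness of [C] also makes [C + l K] measurable and meets the
    boundedness condition in the definition of smoothing. Both claims are one statement about two
    bodies, [K] inside a symmetric [L]: the oscillation of [f] is bounded along [L], that of [T f]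
    along [K]. For (i) [L] is [K]; for (ii) [L] is the outer ball, and the pairs considered for
    [T f] come from the inner one. Fubini's theorem is used for null sets only. Levels [t] for which
    [f > t] has infinite measure are treated apart, since there a comparison of measures says
    nothing. *)

Section outer.
Context {R : realType} {n : nat}.
Implicit Types (A B : set 'rV[R]_n) (c : option ('rV[R]_n * 'rV[R]_n)).
Local Notation mu := (@lebesgue_outer R n).

Lemma lebesgue_outer_box c : (mu (box c) <= box_volume c)%E.
Proof.
apply: ereal_inf_lbound; exists (fun k => if k == 0%N then c else None).
  by move=> x cx; exists 0%N.
rewrite nneseries_recl//; last by move=> k _; exact: box_volume_ge0.
by rewrite eseries0 ?adde0// => -[].
Qed.

Lemma lebesgue_outer_cover A (e : R) : (mu A < +oo)%E -> 0 < e ->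
  exists2 c, A `<=` \bigcup_k box (c k) &
    (\sum_(k <oo) box_volume (c k) <= mu A + e%:E)%E.
Proof.
move=> Aoo e0.
have Afin : mu A \is a fin_num by rewrite ge0_fin_numE// outer_measure_ge0.
have [x [c Ac <-] /ltW xA] := lb_ereal_inf_adherent e0 Afin.
by exists c.
Qed.

Lemma lebesgue_outerU2 A B : (mu (A `|` B) <= mu A + mu B)%E.
Proof. exact: outer_measureU2. Qed.

Lemma lebesgue_null_sub A B : A `<=` B -> mu B = 0%E -> mu A = 0%E.
Proof.
move=> AB B0; apply/eqP; rewrite eq_le outer_measure_ge0 andbT -B0.
exact: le_outer_measure.
Qed.

Lemma lebesgue_null_bigcup (F : (set 'rV[R]_n)^nat) :
  (forall k, mu (F k) = 0%E) -> mu (\bigcup_k F k) = 0%E.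
Proof.
move=> F0; apply/eqP; rewrite eq_le outer_measure_ge0 andbT.
apply: (le_trans (outer_measure_sigma_subadditive mu F)).
rewrite (_ : (\sum_(k <oo) mu (F k) = 0)%E)//.
by apply: eseries0 => k _ _; exact: F0.
Qed.

Lemma lebesgue_null_countable (I : countType) (F : I -> set 'rV[R]_n) :
  (forall i, mu (F i) = 0%E) -> mu (\bigcup_i F i) = 0%E.
Proof.
move=> F0; pose G k := if pickle_inv k is Some i then F i else set0.
apply: (lebesgue_null_sub (B := \bigcup_k G k)) => [x [i _ xi]|].
  by exists (pickle i) => //; rewrite /G pickleK_inv.
apply: lebesgue_null_bigcup => k; rewrite /G.
by case: pickle_inv => [i|]; [exact: F0|exact: outer_measure0].
Qed.

Lemma lebesgue_nullU A B : mu A = 0%E -> mu B = 0%E -> mu (A `|` B) = 0%E.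
Proof.
move=> A0 B0; apply/eqP; rewrite eq_le outer_measure_ge0 andbT.
by rewrite (le_trans (lebesgue_outerU2 _ _))// A0 B0 adde0.
Qed.

Lemma lebesgue_null_eps A : (forall e : R, 0 < e -> (mu A <= e%:E)%E) ->
  mu A = 0%E.
Proof.
move=> Ae; apply/eqP; rewrite eq_le outer_measure_ge0 andbT.
by apply/lee_addgt0Pr => e e0; rewrite add0e; exact: Ae.
Qed.

End outer.

(** A cover of [A] by boxes pulls back box by box along [F], and [l] bounds the growth of volume.
    Translations, dilations, cylinders and coordinate swaps are all of this kind; [D] restricts a
    cylinder to a slab, where the preimage of a box fits in a box. *)
Lemma lebesgue_outer_preimage (R : realType) (m n : nat)
    (g : 'rV[R]_n -> 'rV[R]_m) (D : set 'rV[R]_n) (l : R)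
    (F : option ('rV[R]_m * 'rV[R]_m) -> option ('rV[R]_n * 'rV[R]_n))
    (A : set 'rV[R]_m) :
  0 < l -> (forall c y, D y -> box c (g y) -> box (F c) y) ->
  (forall c, (box_volume (F c) <= l%:E * box_volume c)%E) ->
  (lebesgue_outer (D `&` g @^-1` A) <= l%:E * lebesgue_outer A)%E.
Proof.
move=> l0 gF Fl.
have [->|/eqP] := pselect (lebesgue_outer A = +oo)%E.
  by rewrite gt0_muley ?leey// lte_fin.
rewrite -ltey => Aoo.
apply/lee_addgt0Pr => e e0.
have [|c Ac cA] := lebesgue_outer_cover Aoo (e := e / l); first exact: divr_gt0.
apply: (@le_trans _ _ (\sum_(k <oo) box_volume (F (c k)))%E).
  apply: ereal_inf_lbound; exists (F \o c) => //.
  by move=> y [Dy /Ac[k _ yk]]; exists k => //; exact: gF.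
apply: (@le_trans _ _ (\sum_(k <oo) l%:E * box_volume (c k))%E).
  by apply: lee_nneseries => k *; [exact: box_volume_ge0|exact: Fl].
rewrite nneseriesZl; last by move=> *; exact: box_volume_ge0.
apply: (@le_trans _ _ (l%:E * (lebesgue_outer A + (e / l)%:E))%E).
  by rewrite lee_wpmul2l// lee_fin ltW.
have el0 : 0 <= e / l by rewrite divr_ge0 ?ltW.
rewrite ge0_muleDr ?outer_measure_ge0 ?lee_fin// -EFinM mulrCA divff ?mulr1//.
by rewrite gt_eqF.
Qed.

Section invariance.
Context {R : realType} {n : nat}.
Implicit Types (A B : set 'rV[R]_n).
Local Notation mu := (@lebesgue_outer R n).

Lemma lebesgue_outer_translate (a : 'rV[R]_n) A :
  (mu [set (a + x)%R | x in A] <= mu A)%E.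
Proof.
have -> : [set a + x | x in A] = setT `&` (fun y => y - a) @^-1` A.
  apply/seteqP; split => [_ [x Ax <-]|y [_ Aya]].
    by split => //=; rewrite addrC addKr.
  by exists (y - a) => //; rewrite addrC subrK.
rewrite -[leRHS]mul1e; apply: (lebesgue_outer_preimage
  (F := fun c => if c is Some (u, v) then Some (a + u, a + v) else None)).
- exact: ltr01.
- move=> [[u v]|]//= y _ + i => /(_ i).
  by rewrite !mxE lerBrDl lerBlDl.
- move=> [[u v]|]//=; rewrite mul1e// lee_fin.
  rewrite le_eqVlt; apply/orP; left; apply/eqP/eq_bigr => i _.
  by rewrite !mxE opprD addrACA subrr add0r.
Qed.

Lemma lebesgue_outer_dilate_le (l : R) A : 0 < l ->
  (mu (dilate l A) <= (l ^+ n)%:E * mu A)%E.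
Proof.
move=> l0; have -> : dilate l A = setT `&` (fun y => l^-1 *: y) @^-1` A.
  apply/seteqP; split => [_ [x Ax <-]|y [_ Ay]].
    by split => //=; rewrite scalerA mulVf ?gt_eqF// scale1r.
  by exists (l^-1 *: y) => //; rewrite scalerA mulfV ?gt_eqF// scale1r.
apply: (lebesgue_outer_preimage
  (F := fun c => if c is Some (u, v) then Some (l *: u, l *: v) else None)).
- exact: exprn_gt0.
- move=> [[u v]|]//= y _ + i => /(_ i).
  by rewrite !mxE ler_pdivlMl// ler_pdivrMl.
- move=> [[u v]|]//=; rewrite ?mule0// -EFinM lee_fin.
  rewrite le_eqVlt; apply/orP; left; apply/eqP.
  rewrite -[X in l ^+ X]card_ord -prodr_const -big_split/=.
  apply/eq_bigr => i _.
  by rewrite !mxE -mulrBr maxr_pMr ?mulr0 ?ltW.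
Qed.

Lemma lebesgue_outer_dilate (l : R) A : 0 < l ->
  (mu (dilate l A) = (l ^+ n)%:E * mu A)%E.
Proof.
move=> l0; apply/eqP; rewrite eq_le lebesgue_outer_dilate_le//=.
have /lebesgue_outer_dilate_le : 0 < l^-1 by rewrite invr_gt0.
move=> /(_ (dilate l A)).
have -> : dilate l^-1 (dilate l A) = A.
  apply/seteqP; split => [_ [_ [x Ax <-] <-]|x Ax].
    by rewrite scalerA mulVf ?scale1r// gt_eqF.
  by exists (l *: x); [exists x|rewrite scalerA mulVf ?scale1r// gt_eqF].
move=> H; rewrite (le_trans (lee_wpmul2l _ H))//.
  by rewrite lee_fin exprn_ge0// ltW.
by rewrite muleA -EFinM exprVn divff ?mul1e// expf_neq0// gt_eqF.
Qed.

End invariance.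

(** Cutting the side from [u] to [v] at [a] preserves the total length, also when [a] misses the
    side or the side is empty. *)
Lemma max0_split (R : realDomainType) (u v a : R) :
  Num.max 0 (Num.min v a - u) + Num.max 0 (v - Num.max u a) = Num.max 0 (v - u).
Proof.
have [va|av] := leP v a; have [ua|au] := leP u a;
  do ! (case: (leP 0 _) => ?); lra.
Qed.

(** * Caratheodory measurability and the sup norm *)

Section measurability.
Context {R : realType} {n : nat}.
Local Notation mu := (@lebesgue_outer R n).
Implicit Types (A B : set 'rV[R]_n).

(** The hyperplane cuts each box of a nearly optimal cover of [X] into two boxes whose volumes add
    up exactly: [lo] lowers the upper corner to [a], [hi] raises the lower one. *)
Lemma measurable_halfspace (i : 'I_n) (a : R) :
  lmeasurable [set x : 'rV[R]_n | x ord0 i <= a].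
Proof.
set H := [set x | _].
apply: le_caratheodory_measurable => X.
change (mu (X `&` H) + mu (X `&` ~` H) <= mu X)%E.
have [->|/eqP] := pselect (mu X = +oo)%E; first by rewrite leey.
rewrite -ltey => Xoo; apply/lee_addgt0Pr => e e0.
have [c Xc cX] := lebesgue_outer_cover Xoo e0.
pose lo (v : 'rV[R]_n) := \row_j if j == i then Num.min (v ord0 j) a else v ord0 j.
pose hi (v : 'rV[R]_n) := \row_j if j == i then Num.max (v ord0 j) a else v ord0 j.
pose c1 k := if c k is Some (u, v) then Some (u, lo v) else None.
pose c2 k := if c k is Some (u, v) then Some (hi u, v) else None.
apply: le_trans cX.
have -> : (\sum_(k <oo) box_volume (c k) =
    \sum_(k <oo) (box_volume (c1 k) + box_volume (c2 k)))%E.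
  apply: eq_eseriesr => k _; rewrite /c1 /c2; case: (c k) => [[u v]|]/=.
    rewrite -EFinD; congr (_%:E).
    rewrite (bigD1 i)//= [X in _ = X + _](bigD1 i)//= [X in _ = _ + X](bigD1 i)//=.
    rewrite !mxE eqxx.
    rewrite [X in _ = _ * X + _](eq_bigr (fun j => Num.max 0 (v ord0 j - u ord0 j))).
      rewrite [X in _ = _ + _ * X](eq_bigr (fun j => Num.max 0 (v ord0 j - u ord0 j))).
        by rewrite -mulrDl max0_split.
      by move=> j /negbTE ji; rewrite !mxE ji.
    by move=> j /negbTE ji; rewrite !mxE ji.
  by rewrite adde0.
rewrite nneseriesD; [|by move=> *; exact: box_volume_ge0..].
apply: leeD; apply: ereal_inf_lbound.
  exists c1 => // x [/Xc[k _ kx] Hx]; exists k => //.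
  move: kx; rewrite /c1; case: (c k) => [[u v]|]//= + j => /(_ j) /andP[-> /=].
  by rewrite mxE; case: eqP => // ->; rewrite le_min => ->.
exists c2 => // x [/Xc[k _ kx] /negP Hx]; exists k => //.
move: kx; rewrite /c2; case: (c k) => [[u v]|]//= + j => /(_ j) /andP[+ ->].
rewrite mxE; case: eqP => [-> ux|_ ->//]; rewrite ge_max ux/= andbT.
by rewrite ltW// ltNge.
Qed.

End measurability.

Section norm.
Context {R : realType} {n : nat}.
Implicit Types x : 'rV[R]_n.

Lemma rV_norm_leP x (r : R) : 0 <= r ->
  `|x| <= r <-> forall i, `|x ord0 i| <= r.
Proof.
move=> r0; rewrite [`|x|]mx_normrE; split=> [/bigmax_leP[_ xr] i|xr].
  exact: (xr (ord0, i)).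
by apply/bigmax_leP; split => // -[i j] _ /=; rewrite (ord1 i).
Qed.

Lemma rV_norm_ltP x (r : R) : 0 < r ->
  `|x| < r <-> forall i, `|x ord0 i| < r.
Proof.
move=> r0; rewrite [`|x|]mx_normrE; split=> [/bigmax_ltP[_ xr] i|xr].
  exact: (xr (ord0, i)).
by apply/bigmax_ltP; split => // -[i j] _ /=; rewrite (ord1 i).
Qed.

Lemma rV_rat_approx x (e : R) : 0 < e ->
  exists q : 'rV[rat]_n, `|x - map_mx ratr q| < e.
Proof.
move=> e0.
have /choice[q qP] : forall i, exists p : rat, `|x ord0 i - ratr p| < e.
  move=> i; have [|p] := @rat_in_itvoo R (x ord0 i - e) (x ord0 i + e).
    by lra.
  by rewrite in_itv/= => /andP[? ?]; exists p; rewrite ltr_norml; lra.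
exists (\row_i q i); apply/rV_norm_ltP => // i.
by rewrite !mxE.
Qed.

Lemma closed_cubeE x (r : R) : 0 <= r ->
  [set y | `|y - x| <= r] = box (Some (x - const_mx r, x + const_mx r)).
Proof.
move=> r0; apply/seteqP; split => y /=.
  move=> /rV_norm_leP-/(_ r0) xr i; have := xr i.
  by rewrite !mxE ler_norml; lra.
move=> xr; apply/rV_norm_leP => // i; have := xr i.
by rewrite !mxE ler_norml; lra.
Qed.

End norm.

Section measurability.
Context {R : realType} {n : nat}.
Local Notation mu := (@lebesgue_outer R n).
Implicit Types (A B U : set 'rV[R]_n).

Lemma lmeasurable_box c : lmeasurable (box c : set 'rV[R]_n).
Proof.
case: c => [[a b]|]; last exact: measurable0.
(* Lower bounds come from the same half-spaces: [a i <= x i] fails exactly when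
   [x i <= a i - 1 / (k + 1)] for some [k]. *)
have -> : box (Some (a, b)) = ~` \bigcup_(i : 'I_n)
    ~` ([set x : 'rV[R]_n | x ord0 i <= b ord0 i] `\`
     \bigcup_(k : nat) [set x : 'rV[R]_n | x ord0 i <= a ord0 i - k.+1%:R^-1]).
  apply/seteqP; split => [x abx [i _ /=]|x].
    apply; have /andP[ax xb] := abx i; split => // -[k _ /= xk].
    have k0 : 0 < k.+1%:R^-1 :> R by [].
    by move: xk k0; move: (_^-1) => e xk e0; lra.
  move=> abx i; have [//|xi] := pselect (a ord0 i <= x ord0 i <= b ord0 i).
  exfalso; apply: abx; exists i => // -[xb H]; apply: xi.
  rewrite xb andbT leNgt; apply/negP => xa; apply: H.
  have /ltr_add_invr[k kxa] := xa.
  by exists k => //=; rewrite lerBrDr ltW.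
apply: measurableC; apply: countable_bigcupT_measurable.
  exact: countableP.
move=> i; apply/measurableC/measurableD; first exact: measurable_halfspace.
by apply: bigcupT_measurable => k; exact: measurable_halfspace.
Qed.

(** An open set is the union of the cubes with rational centre and radius [1 / (k + 1)] that it
    contains. *)
Lemma lmeasurable_open U : open U -> lmeasurable U.
Proof.
move=> oU.
pose cube (q : 'rV[rat]_n * nat) :=
  let c := map_mx ratr q.1 : 'rV[R]_n in
  [set y : 'rV[R]_n | `|y - c| <= q.2.+1%:R^-1].
pose F q := if pselect (cube q `<=` U) then cube q else set0.
have -> : U = \bigcup_q F q.
  apply/seteqP; split => [x Ux|x [q _]]; last first.
    by rewrite /F; case: pselect => [qU /qU|_ []].
  have /nbhs_ballP[e/= e0 eU] := open_nbhs_nbhs (conj oU Ux).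
  have [k ke] : exists k : nat, 2 * k.+1%:R^-1 < e.
    have /ltr_add_invr[k] : 0 < e / 2 by lra.
    by exists k; rewrite mulrC -ltr_pdivlMr// -[ltLHS]add0r.
  have k0 : 0 < k.+1%:R^-1 :> R by [].
  have [q xq] := rV_rat_approx x k0.
  exists (q, k) => //; rewrite /F; case: pselect => [_|[]]/=.
    by rewrite /cube/= ltW.
  move=> y /= qy; apply: eU; rewrite -ball_normE/=.
  rewrite (le_lt_trans (ler_distD (map_mx ratr q) _ _))//.
  by rewrite (lt_trans _ ke)// mulr_natl mulr2n ltr_leD// distrC.
apply: countable_bigcupT_measurable; first exact: countableP.
move=> q; rewrite /F; case: pselect => [?|?] /=; last exact: measurable0.
by rewrite /cube closed_cubeE//; exact: lmeasurable_box.
Qed.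

Lemma lmeasurable_closed A : closed A -> lmeasurable A.
Proof.
by rewrite -openC => /lmeasurable_open/measurableC; rewrite setCK.
Qed.

Lemma lmeasurable_compact A : compact A -> lmeasurable A.
Proof.
by move=> /compact_closed cA; apply/lmeasurable_closed/cA/norm_hausdorff.
Qed.

(** Sets of outer measure zero are Caratheodory measurable, so they are their own measurable
    witnesses. Almost-everywhere statements can thus be handled as equations [mu A = 0]. *)
Lemma negligible_lebesgueP A : (lebesgue n).-negligible A <-> mu A = 0%E.
Proof.
split=> [[B [mB B0 AB]]|A0].
  apply/eqP; rewrite eq_le outer_measure_ge0 andbT -B0.
  exact: le_outer_measure.
exists A; split => //; apply: le_caratheodory_measurable => X.
change (mu (X `&` A) + mu (X `&` ~` A) <= mu X)%E.
have -> : mu (X `&` A) = 0%E.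
  apply/eqP; rewrite eq_le outer_measure_ge0 andbT -A0.
  by apply: le_outer_measure; exact: subIsetr.
by rewrite add0e; apply: le_outer_measure; exact: subIsetl.
Qed.

Lemma lmeasurable_negligible A : (lebesgue n).-negligible A -> lmeasurable A.
Proof. exact: measure_is_complete_caratheodory. Qed.

Lemma lebesgue_cube_lty x (r : R) : (mu [set y | `|y - x| <= r]%R < +oo)%E.
Proof.
have [r0|r0] := leP 0 r.
  rewrite closed_cubeE// (le_lt_trans (lebesgue_outer_box _))//.
  by rewrite ltry.
rewrite (_ : mkset _ = set0) ?outer_measure0//.
apply/seteqP; split => // y /= yr.
by have := le_lt_trans yr r0; rewrite normr_lt0.
Qed.

Lemma bounded_sub_cube A : bounded_set A ->
  exists k : nat, A `<=` [set y | `|y| <= k%:R].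
Proof.
move=> [M [Mreal HM]]; have [k Mk] : exists k : nat, M < k%:R.
  by exists (Num.truncn M).+1; exact: truncnS_gt.
by exists k => x Ax; exact: HM Ax.
Qed.

Lemma lebesgue_bounded_lty A : bounded_set A -> (mu A < +oo)%E.
Proof.
move=> /bounded_sub_cube[k Ak].
rewrite (le_lt_trans _ (lebesgue_cube_lty 0 k%:R))//.
by apply: le_outer_measure => x /Ak /=; rewrite subr0.
Qed.

End measurability.

(** * Outer and inner regularity *)

Section regularity.
Context {R : realType} {n : nat}.
Local Notation mu := (@lebesgue_outer R n).
Implicit Types (A B U C : set 'rV[R]_n).

Lemma box_open_enlargement c (e : R) : 0 < e -> exists U,
  [/\ open U, box c `<=` U & (mu U <= box_volume c + e%:E)%E].
Proof.
move=> e0; case: c => [[a b]|]; last first.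
  exists (interior (box None)); split; [exact: open_interior|by []|].
  have -> : interior (box None) = set0 :> set 'rV[R]_n.
    by apply/seteqP; split; [exact: interior_subset|exact: sub0set].
  by rewrite outer_measure0 add0e lee_fin ltW.
(* The volume after moving each face outwards by [t / 2]; it is continuous at [t = 0]. *)
pose vol (t : R) := \prod_i Num.max 0 (b ord0 i - a ord0 i + t).
have vol_cvg : vol t @[t --> 0^'+] --> vol 0.
  apply: cvg_at_right_filter; apply: cvg_big => [|i _]; first exact: mul_continuous.
  apply: (@continuous_max R R (cst 0) (fun t => b ord0 i - a ord0 i + t) 0).
    exact: cvg_cst.
  by apply: cvgD; [exact: cvg_cst|exact: cvg_id].
have : \forall t \near 0^'+, 0 < t /\ vol t < vol 0 + e.
  near=> t; split; first by near: t; exact: nbhs_right_gt.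
  near: t; apply: (cvgr_lt _ vol_cvg); lra.
move=> /filter_ex[t [t0 volt]].
exists (interior (box (Some (a - const_mx (t / 2), b + const_mx (t / 2))))).
split; first exact: open_interior.
  move=> x abx; apply/nbhs_ballP; exists (t / 2) => /=; first lra.
  move=> y; rewrite -ball_normE/= => /rV_norm_ltP xy i.
  have := xy _ i; rewrite !mxE ltr_norml => /(_ ltac:(lra)).
  by have := abx i; lra.
apply: (@le_trans _ _ (mu (box (Some (a - const_mx (t / 2), b + const_mx (t / 2)))))).
  by apply: le_outer_measure; exact: interior_subset.
rewrite (le_trans (lebesgue_outer_box _))//= -EFinD lee_fin.
have -> : \prod_i Num.max 0 ((b + const_mx (t / 2)) ord0 i -
    (a - const_mx (t / 2)) ord0 i) = vol t.
  by apply: eq_bigr => i _; rewrite !mxE; congr Num.max; lra.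
rewrite ltW//; apply: (lt_le_trans volt); rewrite lerD2r.
by rewrite /vol; under eq_bigr do rewrite addr0.
Unshelve. all: by end_near. Qed.

Lemma lebesgue_outer_regular A (e : R) : (mu A < +oo)%E -> 0 < e ->
  exists U, [/\ open U, A `<=` U & (mu U <= mu A + e%:E)%E].
Proof.
move=> Aoo e0.
have e20 : 0 < e / 2 by lra.
have [c Ac cA] := lebesgue_outer_cover Aoo e20.
have /choice[V VP] : forall k : nat, exists U, [/\ open U, box (c k) `<=` U &
    (mu U <= box_volume (c k) + (e / 2 / (2 ^ k.+1)%:R)%:E)%E].
  by move=> k; apply: box_open_enlargement; exact: divr_gt0.
exists (\bigcup_k V k); split.
- by apply: bigcup_open => k _; have [] := VP k.
- by move=> x /Ac[k _ ckx]; exists k => //; have [_ + _] := VP k; exact.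
- apply: (le_trans (outer_measure_sigma_subadditive mu V)).
  apply: (@le_trans _ _ (\sum_(k <oo) (box_volume (c k) + (e / 2 / (2 ^ k.+1)%:R)%:E))%E).
    by apply: lee_nneseries => k *; [exact: outer_measure_ge0|have [_ _] := VP k].
  apply: (le_trans (epsilon_trick _ _ _)).
  + by move=> k; exact: box_volume_ge0.
  + exact: ltW.
  + by rewrite [in leRHS](splitr e) EFinD addeA leeD2r.
Qed.

Lemma lebesgue_setD_le A B (e : R) : lmeasurable A -> lmeasurable B ->
  A `<=` B -> (mu A < +oo)%E -> (mu B <= mu A + e%:E)%E ->
  (mu (B `\` A) <= e%:E)%E.
Proof.
move=> mA mB AB Aoo BAe.
have BE : (mu B = mu (B `\` A) + mu A)%E.
  by have := measureDI (lebesgue n) mB mA; rewrite (setIidr AB).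
move: BAe.
by rewrite BE addeC leeD2lE// ge0_fin_numE// outer_measure_ge0.
Qed.

Lemma cvg_lebesgue_eventually (F : (set 'rV[R]_n)^nat) (e : R) : 0 < e ->
  (forall k, lmeasurable (F k)) -> nonincreasing_seq F ->
  (mu (F 0%N) < +oo)%E -> mu (\bigcap_k F k) = 0%E ->
  exists k, (mu (F k) <= e%:E)%E.
Proof.
move=> e0 mF niF F0oo capF0.
have mcap : lmeasurable (\bigcap_k F k).
  by apply/lmeasurable_negligible/negligible_lebesgueP.
have := @nonincreasing_cvg_mu _ _ _ (lebesgue n) F F0oo mF mcap niF.
rewrite [X in _ --> X]capF0 => /fine_cvgP[Ffin Fcvg].
have [k [Fkfin Fke]] : exists k, (mu (F k)) \is a fin_num /\ fine (mu (F k)) < e.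
  apply: (@filter_ex _ \oo); near=> k; split; near: k; first exact: Ffin.
  exact: (cvgr_lt _ Fcvg).
by exists k; rewrite -(fineK Fkfin) lee_fin ltW.
Unshelve. all: by end_near. Qed.

(** A large cube [Q k] contains [A] up to [e / 2]. Removing from it an open set that covers [Q k]
    minus [A] with excess at most [e / 2] leaves a compact subset of [A]. *)
Lemma lebesgue_inner_regular A (e : R) : lmeasurable A -> (mu A < +oo)%E ->
  0 < e -> exists C, [/\ compact C, C `<=` A & (mu (A `\` C) <= e%:E)%E].
Proof.
move=> mA Aoo e0.
pose Q (k : nat) := [set x : 'rV[R]_n | `|x| <= k%:R].
have QE k : Q k = box (Some (0 - const_mx k%:R, 0 + const_mx k%:R)).
  by rewrite -closed_cubeE//; apply/seteqP; split => x /=; rewrite subr0.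
have mQ k : lmeasurable (Q k) by rewrite QE; exact: lmeasurable_box.
have Qoo k : (mu (Q k) < +oo)%E.
  rewrite QE (le_lt_trans (lebesgue_outer_box _))// ltry//.
have e20 : 0 < e / 2 by lra.
have [k AQk] : exists k, (mu (A `\` Q k) <= (e / 2)%:E)%E.
  apply: (cvg_lebesgue_eventually (F := fun k => A `\` Q k)) => //.
  - by move=> k; apply: measurableD; [exact: mA|exact: mQ].
  - move=> k l kl; apply/subsetPset => x [Ax nQx]; split => // Qx; apply: nQx.
    by rewrite /Q/= (le_trans Qx)// ler_nat.
  - by apply: le_lt_trans Aoo; apply: le_outer_measure; exact: subDsetl.
  - rewrite (_ : \bigcap_k _ = set0) ?outer_measure0//.
    apply/seteqP; split => // x /(_ (Num.truncn `|x|).+1 I)[_]; apply.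
    by rewrite /Q/= ltW// truncnS_gt.
have AQoo : (mu (Q k `\` A) < +oo)%E.
  by apply: le_lt_trans (Qoo k); apply: le_outer_measure; exact: subDsetl.
have [U [oU QAU UQA]] := lebesgue_outer_regular AQoo e20.
exists (Q k `\` U); split.
- apply: bounded_closed_compact.
    exists k%:R; split; first exact: num_real.
    by move=> M kM x [/= xk _]; rewrite (le_trans xk)// ltW.
  apply: closedI; last by rewrite -openC setCK.
  rewrite [Q k](_ : _ = (fun x => `|x|) @^-1` [set r | r <= k%:R])//.
  apply: closed_comp; last exact: closed_le.
  by move=> ? _; exact: norm_continuous.
- by move=> x [Qx nUx]; apply: contrapT => nAx; apply: nUx; exact: QAU.
- have sub : A `\` (Q k `\` U) `<=` (A `\` Q k) `|` (U `\` (Q k `\` A)).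
    move=> x [Ax QU]; have [Qx|nQx] := pselect (Q k x); last by left.
    right; split; last by case.
    by apply: contrapT => nUx; exact: QU.
  apply: (le_trans (le_outer_measure mu _ _ sub)).
  apply: (le_trans (lebesgue_outerU2 _ _)).
  rewrite [e]splitr EFinD leeD//.
  have mQA : lmeasurable (Q k `\` A) by apply: measurableD; [exact: mQ|exact: mA].
  by apply: lebesgue_setD_le => //; exact: lmeasurable_open.
Qed.

End regularity.

(** * Null sets of a product *)

Section product.
Context {R : realType} {m n : nat}.
Implicit Types c : option ('rV[R]_(m + n) * 'rV[R]_(m + n)).

Definition lsubbox c : option ('rV[R]_m * 'rV[R]_m) :=
  if c is Some (a, b) then Some (lsubmx a, lsubmx b) else None.

Definition rsubbox c : option ('rV[R]_n * 'rV[R]_n) :=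
  if c is Some (a, b) then Some (rsubmx a, rsubmx b) else None.

Lemma box_split c z :
  box c z <-> box (lsubbox c) (lsubmx z) /\ box (rsubbox c) (rsubmx z).
Proof.
case: c => [[a b]|] /=; last by split => // -[].
split=> [abz|[lz rz] i].
  by split => i; rewrite !mxE; exact: abz.
by case: (split_ordP i) => j ->;
  [have := lz j|have := rz j]; rewrite !mxE.
Qed.

Lemma box_volume_split c :
  box_volume c = (box_volume (lsubbox c) * box_volume (rsubbox c))%E.
Proof.
case: c => [[a b]|] /=; last by rewrite mul0e.
rewrite -EFinM big_split_ord/=; congr (_ * _)%:E;
  by apply: eq_bigr => i _; rewrite !mxE.
Qed.

(** In the slab where the second component has norm at most [k + 1], a box of a cover of [N] is
    extended by a cube of side [2 * (k + 1)], which multiplies volumes by a fixed factor. *)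
Lemma lebesgue_null_lsub (N : set 'rV[R]_m) : lebesgue_outer N = 0%E ->
  lebesgue_outer [set z : 'rV[R]_(m + n) | N (lsubmx z)] = 0%E.
Proof.
move=> N0.
pose Q (k : nat) := [set z : 'rV[R]_(m + n) | `|rsubmx z| <= k.+1%:R].
have QN0 k : lebesgue_outer (Q k `&` (fun z => lsubmx z) @^-1` N) = 0%E.
  suff : (lebesgue_outer (Q k `&` (fun z => lsubmx z) @^-1` N) <=
      ((2 * k.+1%:R) ^+ n)%:E * lebesgue_outer N)%E.
    rewrite N0 mule0 => H.
    by apply/eqP; rewrite eq_le H outer_measure_ge0.
  pose F (c : option ('rV[R]_m * 'rV[R]_m)) :
      option ('rV[R]_(m + n) * 'rV[R]_(m + n)) := if c is Some (a, b)
    then Some (row_mx a (const_mx (- k.+1%:R)), row_mx b (const_mx k.+1%:R))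
    else None.
  apply: (lebesgue_outer_preimage (F := F)).
  - by rewrite exprn_gt0// mulr_gt0.
  - move=> [[a b]|]//= z /rV_norm_leP-/(_ (ler0n _ _)) zk abz i.
    case: (split_ordP i) => j ->.
      by have := abz j; rewrite !(row_mxEl, mxE).
    by have := zk j; rewrite !(row_mxEr, mxE) ler_norml.
  - move=> [[a b]|]; last by rewrite /= mule0.
    rewrite box_volume_split/= !row_mxKl !row_mxKr muleC lee_pmul//.
    + by rewrite lee_fin; apply: prodr_ge0 => i _; rewrite le_max lexx.
    + by rewrite lee_fin; apply: prodr_ge0 => i _; rewrite le_max lexx.
    + rewrite lee_fin -[X in _ ^+ X]card_ord -prodr_const ler_prod// => i _.
      rewrite !mxE opprK le_max lexx/= ge_max.
      by rewrite mulr_natl mulr2n lexx andbT addr_ge0.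
apply: lebesgue_null_sub (lebesgue_null_bigcup QN0) => z Nz.
exists (Num.truncn `|rsubmx z|) => //; split => //.
by rewrite /Q/= ltW// truncnS_gt.
Qed.

End product.

Lemma lebesgue_null_swap (R : realType) (m n : nat) (N : set 'rV[R]_(n + m)) :
  lebesgue_outer N = 0%E ->
  lebesgue_outer [set z : 'rV[R]_(m + n) | N (row_mx (rsubmx z) (lsubmx z))] = 0%E.
Proof.
move=> N0; pose g (z : 'rV[R]_(m + n)) := row_mx (rsubmx z) (lsubmx z).
suff : (lebesgue_outer (setT `&` g @^-1` N) <= 1%:E * lebesgue_outer N)%E.
  by rewrite N0 mule0 setTI => H; apply/eqP; rewrite eq_le H outer_measure_ge0.
pose F (c : option ('rV[R]_(n + m) * 'rV[R]_(n + m))) :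
    option ('rV[R]_(m + n) * 'rV[R]_(m + n)) := if c is Some (a, b)
  then Some (row_mx (rsubmx a) (lsubmx a), row_mx (rsubmx b) (lsubmx b))
  else None.
apply: (lebesgue_outer_preimage (F := F)).
- exact: ltr01.
- move=> c z _ /box_split; rewrite /g row_mxKl row_mxKr => -[lz rz].
  by apply/box_split; case: c lz rz => [[a b]|]//=; rewrite !row_mxKl !row_mxKr.
- move=> c; rewrite mul1e !box_volume_split.
  by case: c => [[a b]|]/=; rewrite ?mul0e// !row_mxKl !row_mxKr muleC.
Qed.

Lemma lebesgue_null_rsub (R : realType) (m n : nat) (N : set 'rV[R]_n) :
  lebesgue_outer N = 0%E ->
  lebesgue_outer [set z : 'rV[R]_(m + n) | N (rsubmx z)] = 0%E.
Proof.
move=> /(@lebesgue_null_lsub R n m)/lebesgue_null_swap.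
by apply: lebesgue_null_sub => z /=; rewrite row_mxKl.
Qed.

(* Markov's inequality for the series [g] of the volumes of the sections of
   a cover of [N] by boxes. *)
Lemma lebesgue_null_sections (R : realType) (m n : nat)
    (N : set 'rV[R]_(m + n)) : lebesgue_outer N = 0%E ->
  lebesgue_outer
    [set x : 'rV[R]_m | lebesgue_outer [set y | N (row_mx x y)] <> 0%E] = 0%E.
Proof.
move=> N0.
pose S x := lebesgue_outer [set y | N (row_mx x y)].
suff P0 (k : nat) : lebesgue_outer [set x | (k.+1%:R^-1%:E <= S x)%E] = 0%E.
  apply: lebesgue_null_sub (lebesgue_null_bigcup P0) => x Sx.
  have {Sx} : (0 < S x)%E by rewrite lt0e outer_measure_ge0 andbT; exact/eqP.
  case E : (S x) => [r||]; last 2 first.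
  - by exists 0%N => //=; rewrite E leey.
  - by [].
  rewrite lte_fin => r0; have := ltr_add_invr r0.
  by move=> [k]; rewrite add0r => kr; exists k => //=; rewrite E lee_fin ltW.
have k0 : 0 < k.+1%:R^-1 :> R by [].
apply: lebesgue_null_eps => e e0.
(* Markov's inequality at the threshold [1 / (k + 1)] turns the total volume [e / (k + 1)] into the
   bound [e]. *)
have [|c Nc ce] := lebesgue_outer_cover (A := N) _ (divr_gt0 e0 (ltr0Sn R k)).
  by rewrite N0 ltry.
rewrite N0 add0e in ce.
pose w (j : nat) (x : 'rV[R]_m) : \bar R :=
  ((\1_(box (lsubbox (c j))) x)%:E * box_volume (rsubbox (c j)))%E.
have w0 j x : (0 <= w j x)%E by rewrite mule_ge0 ?box_volume_ge0// lee_fin.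
pose g x : \bar R := (\sum_(j <oo) w j x)%E.
have Sg x : (S x <= g x)%E.
  apply: ereal_inf_lbound.
  exists (fun j => if x \in box (lsubbox (c j)) then rsubbox (c j) else None).
    move=> y /Nc[j _ /box_split]; rewrite row_mxKl row_mxKr => -[xc yc].
    by exists j => //; rewrite (mem_set xc).
  apply: eq_eseriesr => j _; rewrite /w indicE.
  by case: ifPn => _; rewrite ?mul1e ?mul0e.
have mlb j : lmeasurable (box (lsubbox (c j))) by exact: lmeasurable_box.
have mw j : @measurable_fun _ _ (lebesgueRn R m) (\bar R) setT (w j).
  apply: emeasurable_funM; last exact: measurable_cst.
  by apply/measurable_EFinP; apply: measurable_indic; exact: mlb.
have mg : @measurable_fun _ _ (lebesgueRn R m) (\bar R) setT g.
  have := @ge0_emeasurable_sum _ (lebesgueRn R m) R setT w xpredT.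
  by apply => // j x _ _; exact: w0.
have g0 x : (0 <= g x)%E by apply: nneseries_ge0 => j _ _; exact: w0.
have intg : (\int[lebesgue m]_x g x <= (e / k.+1%:R)%:E)%E.
  apply: le_trans ce; rewrite integral_nneseries//.
  apply: lee_nneseries => j *; first by apply: integral_ge0 => x ?; exact: w0.
  rewrite ge0_integralZr ?box_volume_ge0//; last first.
    by apply/measurable_EFinP; apply: measurable_indic; exact: mlb.
  rewrite integral_indic; [|exact: measurableT|exact: mlb].
  rewrite setIT box_volume_split lee_wpmul2r ?box_volume_ge0//.
  exact: lebesgue_outer_box.
have := @le_integral_comp_abse _ (lebesgueRn R m) R (lebesgue m) setT
  measurableT g k.+1%:R^-1 id.
move=> /(_ (@measurable_id _ _ _)) /(_ (fun _ => id)) /(_ (fun _ _ _ _ => id)).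
rewrite setTI => /(_ mg k0) H.
have {}H : (k.+1%:R^-1%:E * lebesgue_outer [set x | k.+1%:R^-1%:E <= `|g x|] <=
    (e / k.+1%:R)%:E)%E.
  by apply: le_trans intg; under eq_integral do rewrite -(gee0_abs (g0 _)).
apply: (@le_trans _ _ (lebesgue_outer [set x | k.+1%:R^-1%:E <= `|g x|])%E).
  by apply: le_outer_measure => x /= /le_trans; apply; rewrite gee0_abs.
by move: H; rewrite EFinM muleC lee_pmul2r.
Qed.

(** * Radial boundaries *)

Lemma continuous_dilate (R : realType) n (l : R) :
  continuous (fun x : 'rV[R]_n => l *: x).
Proof. exact: scaler_continuous. Qed.

Lemma compact_dilate (R : realType) n (l : R) (A : set 'rV[R]_n) :
  compact A -> compact (dilate l A).
Proof.
move=> cA; rewrite /dilate; apply: continuous_compact => //.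
by apply: continuous_subspaceT; exact: continuous_dilate.
Qed.

Section radial.
Context {R : realType} {n : nat}.
Local Notation mu := (@lebesgue_outer R n).
Implicit Types (A : set 'rV[R]_n).

(* [A \ l A] has measure [(1 - l ^ n) mu A], which tends to [0] as [l]
   increases to [1]. *)
Lemma lebesgue_radial_boundary A : compact A ->
  (forall l : R, 0 < l < 1 -> dilate l A `<=` A) ->
  mu [set x | A x /\ forall l : R, 0 < l < 1 -> ~ dilate l A x] = 0%E.
Proof.
move=> cA starA.
have Aoo : (mu A < +oo)%E.
  by apply/lebesgue_bounded_lty/compact_bounded.
have Afin : mu A \is a fin_num by rewrite ge0_fin_numE// outer_measure_ge0.
apply: lebesgue_null_eps => e e0.
have [l [l01 le]] : exists l : R, 0 < l < 1 /\ fine (mu A) - e < l ^+ n * fine (mu A).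
  have : (l ^+ n * fine (mu A)) @[l --> (1 : R)^'-] --> 1 ^+ n * fine (mu A).
    apply: cvg_at_left_filter; apply: cvgM; last exact: cvg_cst.
    exact: exprn_continuous.
  rewrite expr1n mul1r => cvgl.
  apply: (@filter_ex _ (1 : R)^'-); near=> l; split.
    apply/andP; split; near: l; first by apply: nbhs_left_gt; exact: ltr01.
    exact: nbhs_left_lt.
  by near: l; apply: (cvgr_gt _ cvgl); lra.
apply: (@le_trans _ _ (mu (A `\` dilate l A))).
  by apply: le_outer_measure => x [Ax nx]; split => //; exact: nx.
have [l0 _] := andP l01.
apply: lebesgue_setD_le.
- exact/lmeasurable_compact/compact_dilate.
- exact/lmeasurable_compact.
- exact: starA.
- by rewrite lebesgue_outer_dilate// lte_mul_pinfty// lee_fin exprn_ge0// ltW.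
- rewrite lebesgue_outer_dilate// -(fineK Afin) -EFinM -EFinD lee_fin; lra.
Unshelve. all: by end_near. Qed.

End radial.

Lemma continuous_rVdiff (R : realType) (n : nat) :
  continuous (fun z : 'rV[R]_(n + n) => lsubmx z - rsubmx z).
Proof.
have lip (z w : 'rV[R]_(n + n)) :
    `|(lsubmx z - rsubmx z) - (lsubmx w - rsubmx w)| <= 2 * `|z - w|.
  apply/rV_norm_leP; first by rewrite mulr_ge0.
  move=> i; rewrite !mxE.
  have /rV_norm_leP-/(_ (normr_ge0 _)) zw := lexx `|z - w|.
  have := zw (lshift n i); have := zw (rshift n i); rewrite !mxE.
  rewrite !ler_norml; lra.
move=> z; have FF : Filter (nbhs z) := nbhs_filter z.
apply/(@cvgrPdist_lt _ _ _ _ FF) => e e0; near=> w.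
rewrite (le_lt_trans (lip _ _))// -ltr_pdivlMl// mulrC.
near: w; apply/nbhs_ballP; exists (e / 2) => /=; first by rewrite divr_gt0.
by move=> w; rewrite -ball_normE.
Unshelve. all: by end_near. Qed.

(** The pairs with difference in [D] may have infinite measure, so they are cut by the conditions
    [|z| <= k]. The pieces are compact and stable under contraction, and by linearity of the
    difference their dilates lie over those of [D]. *)
Lemma ae_radial_boundary (R : realType) (n : nat) (D : set 'rV[R]_n) :
  closed D -> (forall l : R, 0 < l < 1 -> dilate l D `<=` D) ->
  lebesgue_outer [set z : 'rV[R]_(n + n) | D (lsubmx z - rsubmx z) /\
    forall l : R, 0 < l < 1 -> ~ dilate l D (lsubmx z - rsubmx z)] = 0%E.
Proof.
move=> cD starD.
pose A (k : nat) := [set z : 'rV[R]_(n + n) | `|z| <= k%:R] `&`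
  (fun z => lsubmx z - rsubmx z) @^-1` D.
have dilA (l : R) k z : dilate l (A k) z ->
    dilate l D (lsubmx z - rsubmx z).
  move=> [w [_ Dw] <-]; exists (lsubmx w - rsubmx w) => //.
  by apply/rowP => i; rewrite !mxE mulrBr.
have cA k : compact (A k).
  apply: bounded_closed_compact.
    exists k%:R; split; first exact: num_real.
    by move=> M kM z [/= zk _]; rewrite (le_trans zk)// ltW.
  apply: closedI; last first.
    by apply: closed_comp cD => z _; exact: continuous_rVdiff.
  rewrite [X in closed X](_ : _ = (fun x => `|x|) @^-1` [set r | r <= k%:R])//.
  apply: closed_comp; last exact: closed_le.
  by move=> ? _; exact: norm_continuous.
have starA k (l : R) : 0 < l < 1 -> dilate l (A k) `<=` A k.
  move=> l01 z lz; split; last by apply: starD (dilA _ _ _ lz).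
  move: lz => [w [wk _] <-]; rewrite /= normrZ gtr0_norm; last lra.
  by rewrite -[leRHS]mul1r ler_pM//; lra.
apply: lebesgue_null_sub (lebesgue_null_bigcup (fun k =>
  lebesgue_radial_boundary (cA k) (starA k))) => z [Dz nz].
exists (Num.truncn `|z|).+1 => //; split.
  by split => //=; rewrite ltW// truncnS_gt.
by move=> l l01 /dilA; exact: nz.
Qed.

(** * The density theorem *)

(* The greedy choice of sets of almost maximal size, as an appeal to Zorn's
   lemma: the third clause below passes to unions of chains, and a maximal
   family with that property meets every member of [D]. *)
Lemma vitali_selection (R : realType) (I : Type) (V : Type) (B : I -> set V)
    (r : I -> R) (D : set I) (M : R) :
  (forall i, D i -> B i !=set0) -> (forall i, D i -> 0 < r i <= M) ->
  exists E, [/\ E `<=` D, trivIset E B &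
    forall i, D i -> exists j, [/\ E j, B i `&` B j !=set0 & r i <= 2 * r j]].
Proof.
move=> B0 rM.
pose P (E : set I) := [/\ E `<=` D, trivIset E B &
  forall i, D i -> (exists2 j, E j & B i `&` B j !=set0) ->
    exists j, [/\ E j, B i `&` B j !=set0 & r i <= 2 * r j]].
have [|E [PE maxE]] := @Zorn_bigcup I P.
  move=> F FP totF; split.
  - by move=> i [X FX Xi]; have [+ _ _] := FP _ FX; exact.
  - move=> i j [X FX Xi] [Y FY Yj].
    have [XY|YX] := totF _ _ FX FY.
      by have [_ + _] := FP _ FY; apply => //; exact: XY.
    by have [_ + _] := FP _ FX; apply => //; exact: YX.
  - move=> i Di [j [X FX Xj] ij]; have [_ _ +] := FP _ FX.
    by move=> /(_ i Di)[|k [Xk ik rik]]; [exists j|exists k; split => //; exists X].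
have [ED tE maxr] := PE.
exists E; split => // i Di; apply: (maxr i Di); apply: contrapT => iE.
pose S := [set r k | k in [set k | D k /\ forall j, E j -> ~ (B k `&` B j !=set0)]].
have Sri : S (r i) by exists i => //; split => // j Ej ij; apply: iE; exists j.
have supS : has_sup S.
  by split; [exists (r i)|exists M => _ [k [Dk _] <-]; have /andP[] := rM _ Dk].
have s0 : 0 < sup S.
  by rewrite (lt_le_trans _ (ub_le_sup supS.2 Sri))//; have /andP[] := rM _ Di.
have [|_ [k [Dk kE] <-] krS] := @sup_adherent R S (sup S / 2) _ supS.
  by rewrite divr_gt0.
have nEk : ~ E k.
  by move=> Ek; apply: (kE k Ek); rewrite setIid; exact: B0.
apply: (maxE (E `|` [set k])).
  split; first by move=> ?; left.
  by move=> /(_ k) Ek; apply: nEk; apply: Ek; right.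
split.
- by move=> j [/ED//|->].
- move=> a b [Ea|->] [Eb|->] ab //; first exact: tE.
  + by exfalso; apply: (kE a Ea); rewrite setIC.
  + by exfalso; exact: (kE b Eb).
- move=> j Dj jEk.
  have [[l El jl]|nj] := pselect (exists2 l, E l & B j `&` B l !=set0).
    by have [|q [Eq jq rjq]] := maxr j Dj; [exists l|exists q; split => //; left].
  have jk : B j `&` B k !=set0.
    by have [l [El|->] //] := jEk; move=> jl; exfalso; apply: nj; exists l.
  exists k; split => //; first by right.
  have : r j <= sup S.
    apply: (ub_le_sup supS.2); exists j => //; split => // l El jl.
    by apply: nj; exists l.
  lra.
Qed.

(** * Cubes and Euclidean balls *)

Section cubes.
Context {R : realType} {n : nat}.
Local Notation mu := (@lebesgue_outer R n).
Implicit Types (x y : 'rV[R]_n).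

Definition cube x (r : R) : set 'rV[R]_n := [set y | `|y - x| <= r].

(** Up to translation, one cube is the dilate of the other by [l]; they are compared without
    evaluating either measure. *)
Lemma lebesgue_cube_le x y (l r : R) : 0 < l ->
  (mu (cube y (l * r)) <= (l ^+ n)%:E * mu (cube x r))%E.
Proof.
move=> l0; rewrite -lebesgue_outer_dilate//.
apply: le_trans (lebesgue_outer_translate (y - l *: x) _).
apply: le_outer_measure => z zy.
exists (z - (y - l *: x)); last by rewrite addrC subrK.
exists (x + l^-1 *: (z - y)).
  rewrite /cube/= addrC addKr normrZ gtr0_norm ?invr_gt0//.
  by rewrite ler_pdivrMl.
rewrite scalerDr scalerA divff ?gt_eqF// scale1r opprB.
by rewrite addrCA.
Qed.

Lemma lmeasurable_cube x (r : R) : lmeasurable (cube x r).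
Proof.
have [r0|r0] := leP 0 r; first by rewrite /cube closed_cubeE//; exact: lmeasurable_box.
rewrite (_ : cube x r = set0); first exact: measurable0.
apply/seteqP; split => // y /= yr.
by have := le_lt_trans yr r0; rewrite normr_lt0.
Qed.

Lemma enorm_ge0 x : 0 <= enorm x.
Proof. exact: sqrtr_ge0. Qed.

Lemma norm_le_enorm x : `|x| <= enorm x.
Proof.
apply/rV_norm_leP; first exact: enorm_ge0.
move=> i; rewrite -sqrtr_sqr ler_wsqrtr// (bigD1 i)//= lerDl.
by apply: sumr_ge0 => j _; exact: sqr_ge0.
Qed.

(** The constant is crude, but positive for every [n], so that radii can be divided by it. *)
Lemma enorm_le_norm x : enorm x <= n.+1%:R * `|x|.
Proof.
rewrite -(ger0_norm (ler0n R n.+1)) -(normr_id x) -normrM -sqrtr_sqr.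
rewrite ler_wsqrtr// exprMn.
apply: (@le_trans _ _ (\sum_(i < n) `|x| ^+ 2)).
  apply: ler_sum => i _; rewrite -real_normK ?num_real//.
  have /rV_norm_leP-/(_ (normr_ge0 _)) xx := lexx `|x|.
  by rewrite ler_pXn2r ?nnegrE.
rewrite sumr_const card_ord -[leLHS]mulr_natl ler_wpM2r ?sqr_ge0//.
by rewrite -natrX ler_nat (leq_trans (leqnSn n))// expnS expn1 leq_pmulr.
Qed.

Lemma enormZ (l : R) x : 0 <= l -> enorm (l *: x) = l * enorm x.
Proof.
move=> l0; rewrite /enorm; under eq_bigr do rewrite mxE exprMn.
by rewrite -mulr_sumr sqrtrM ?sqr_ge0// sqrtr_sqr ger0_norm.
Qed.

Lemma enormN x : enorm (- x) = enorm x.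
Proof. by rewrite /enorm; under eq_bigr do rewrite mxE sqrrN. Qed.

Lemma eball_sub_cube x (r : R) : eball x r `<=` cube x r.
Proof. by move=> y; exact/le_trans/norm_le_enorm. Qed.

Lemma cube_sub_eball x (r : R) : cube x (r / n.+1%:R) `<=` eball x r.
Proof.
move=> y /= yx; rewrite /eball/= (le_trans (enorm_le_norm _))//.
by rewrite mulrC -ler_pdivlMr.
Qed.

Lemma continuous_enorm : continuous (@enorm R n).
Proof.
have sumc : continuous (fun x : 'rV[R]_n => \sum_i x ord0 i ^+ 2).
  apply: continuous_big => [|i _ x]; first exact: add_continuous.
  apply: (@continuous_comp _ _ _ (fun x : 'rV[R]_n => x ord0 i) (fun t => t ^+ 2)).
    exact: coord_continuous.
  exact: exprn_continuous.
move=> x; apply: continuous_comp; first exact: sumc.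
exact: sqrt_continuous.
Qed.

Lemma closed_eball x (r : R) : closed (eball x r).
Proof.
rewrite (_ : eball x r = (fun y => enorm (y - x)) @^-1` [set t | t <= r])//.
apply: closed_comp; last exact: closed_le.
move=> y _; apply: (@continuous_comp _ _ _ (fun y => y - x) enorm).
  by apply: continuousB; [exact: cvg_id|exact: cst_continuous].
exact: continuous_enorm.
Qed.

Lemma eball_lty x (r : R) : (mu (eball x r) < +oo)%E.
Proof.
apply: le_lt_trans (lebesgue_cube_lty x r).
by apply: le_outer_measure; exact: eball_sub_cube.
Qed.

End cubes.

Section density.
Context {R : realType} {n : nat}.
Local Notation mu := (@lebesgue_outer R n).
Implicit Types (A E G : set 'rV[R]_n) (x y : 'rV[R]_n).

(* Take an open [U] containing [G] with [mu U] close to [mu G], and disjoint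
   cubes [Q] in [U] whose enlargements cover [G] and in which [~` E] has
   proportion at least [1 / C].  Then [mu G] is at most the sum of the
   [C * mu (Q \ E)], hence at most [C * mu (U \ E)], which is at most
   [C * (mu U - mu G)].  Rational cubes make the family countable. *)
Lemma vitali_null E G (eps : R) : lmeasurable E -> G `<=` E ->
  (mu G < +oo)%E -> 0 < eps ->
  (forall x, G x -> forall d : R, 0 < d -> exists r : R, 0 < r < d /\
     (eps%:E * mu (eball x r) <= mu (eball x r `\` E))%E) ->
  mu G = 0%E.
Proof.
move=> mE GE Goo eps0 dense.
(* Cubes chosen at scale [r] have radius below [3 * r], hence enlargements of radius below [15 * r],
   while the ball of radius [r] contains a cube of radius [r / (n + 1)]. [L] is the ratio of these
   volumes. *)
pose L : R := (15 * n.+1%:R) ^+ n.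
have L0 : 0 < L by rewrite exprn_gt0// mulr_gt0.
pose C := L / eps.
have C0 : 0 < C by rewrite divr_gt0.
apply: lebesgue_null_eps => e e0.
have [U [oU GU Ue]] := lebesgue_outer_regular Goo (divr_gt0 e0 C0).
have mU := lmeasurable_open oU.
have UE : (mu (U `\` E) <= (e / C)%:E)%E.
  have UIEoo : (mu (U `&` E) < +oo)%E.
    apply: (@le_lt_trans _ _ (mu G + (e / C)%:E)%E); last first.
      by rewrite lte_add_pinfty// ltry.
    by apply: le_trans Ue; apply: le_outer_measure; exact: subIsetl.
  have UI : (mu U = mu (U `\` E) + mu (U `&` E))%E.
    exact: (measureDI (lebesgue n) mU mE).
  have UIEfin : mu (U `&` E) \is a fin_num.
    by rewrite ge0_fin_numE// outer_measure_ge0.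
  rewrite -(leeD2rE _ _ UIEfin) -UI (le_trans Ue)// addeC leeD2l//.
  by apply: le_outer_measure => x Gx; split; [exact: GU|exact: GE].
pose ctr (i : 'rV[rat]_n * rat) : 'rV[R]_n := map_mx ratr i.1.
pose rad (i : 'rV[rat]_n * rat) : R := ratr i.2.
pose Q i := cube (ctr i) (rad i).
pose D := [set i | [/\ 0 < rad i <= 1, Q i `<=` U &
  (mu (cube (ctr i) (5 * rad i)) <= C%:E * mu (Q i `\` E))%E]].
have DQ0 i : D i -> Q i !=set0.
  move=> [/andP[ri _] _ _]; exists (ctr i).
  by rewrite /Q /cube/= subrr normr0 ltW.
have Drad i : D i -> 0 < rad i <= 1 by case.
have [S [SD tS Smax]] := vitali_selection DQ0 Drad.
have GD x : G x -> exists2 i, D i & Q i x.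
  move=> Gx; have /nbhs_ballP[d/= d0 dU] := open_nbhs_nbhs (conj oU (GU _ Gx)).
  (* Points of the chosen cube will lie within [4 * r] of [x], hence in [U]; [r < 1 / 3] keeps its
     radius below [1]. *)
  have [|r [/andP[r0 rd] rE]] := dense x Gx (Num.min (d / 6) (1 / 3)).
    by rewrite lt_min !divr_gt0.
  have {rd}[rd r1] : r < d / 6 /\ r < 1 / 3 by move: rd; rewrite lt_min => /andP.
  have [q xq] := rV_rat_approx x r0.
  (* The centre is within [r] of [x], so a radius above [2 * r] makes the cube contain the ball of
     radius [r] about [x]. *)
  have [|p] := @rat_in_itvoo R (2 * r) (3 * r); first lra.
  rewrite in_itv/= => /andP[rp pr].
  have xQ : Q (q, p) x by rewrite /Q/cube/= /ctr/rad/= ltW// (lt_trans xq)//; lra.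
  exists (q, p) => //; split; rewrite /rad/=.
  - by apply/andP; split; lra.
  - move=> y; rewrite /Q/cube/= /ctr/rad/= => yq; apply: dU.
    rewrite -ball_normE/= (le_lt_trans (ler_distD (map_mx ratr q) _ _))//.
    by rewrite (distrC _ y) in yq *; lra.
  - have xqp : eball x r `<=` Q (q, p).
      move=> y /eball_sub_cube; rewrite /Q/cube/= /ctr/rad/= => yx.
      by rewrite (le_trans (ler_distD x _ _))//; lra.
    apply: (@le_trans _ _ (L%:E * mu (eball x r))%E).
      apply: (@le_trans _ _ (mu (cube (ctr (q, p)) (15 * n.+1%:R * (r / n.+1%:R))))).
        have -> : 15 * n.+1%:R * (r / n.+1%:R) = 15 * r.
          by rewrite -mulrA (mulrC r) mulVKf// pnatr_eq0.
        by apply: le_outer_measure => y; rewrite /cube/= /rad/= => yr; lra.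
      have n15 : 0 < 15 * n.+1%:R :> R by rewrite mulr_gt0.
      apply: (le_trans (lebesgue_cube_le x _ _ n15)).
      rewrite lee_wpmul2l ?lee_fin ?(ltW L0)//.
      by apply: le_outer_measure; exact: cube_sub_eball.
    rewrite /C EFinM -muleA lee_wpmul2l ?lee_fin ?(ltW L0)//.
    rewrite -(@lee_pmul2l _ eps%:E)// muleA -EFinM divff ?gt_eqF// mul1e.
    apply: (le_trans rE); apply: le_outer_measure => y [xy nEy].
    by split => //; exact: xqp.
pose F k := if pickle_inv k is Some i then
  if i \in S then Q i `\` E else set0 else set0 : set 'rV[R]_n.
pose F5 k := if pickle_inv k is Some i then
  if i \in S then cube (ctr i) (5 * rad i) else set0 else set0 : set 'rV[R]_n.
have mF k : lmeasurable (F k).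
  rewrite /F; case: pickle_inv => [i|]; last exact: measurable0.
  case: ifPn => _; last exact: measurable0.
  by apply: measurableD; [exact: lmeasurable_cube|exact: mE].
have F5F k : (mu (F5 k) <= C%:E * mu (F k))%E.
  rewrite /F5 /F; case: pickle_inv => [i|]; last by rewrite outer_measure0 mule0.
  case: ifPn => [/set_mem/SD[]//|_]; by rewrite outer_measure0 mule0.
have tF : trivIset setT F.
  move=> k l _ _ []; rewrite /F => x [].
  case Ek : (pickle_inv k) => [i|//]; case: ifPn => [/set_mem Si [xi _]|//].
  case El : (pickle_inv l) => [j|//]; case: ifPn => [/set_mem Sj [xj _]|//].
  have ij : i = j by apply: tS => //; exists x.
  have := @pickle_invK ('rV[rat]_n * rat)%type k; rewrite Ek/= => <-.
  by have := @pickle_invK ('rV[rat]_n * rat)%type l; rewrite El/= => <-; rewrite ij.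
have GF5 : G `<=` \bigcup_k F5 k.
  move=> x /GD[i Di xi]; have [j [Sj [y [yi yj]] rij]] := Smax i Di.
  exists (pickle j) => //; rewrite /F5 pickleK_inv (mem_set Sj) /cube/=.
  rewrite (le_trans (ler_distD y _ _))//.
  move: yi yj xi; rewrite /Q/cube/= => yi yj xi.
  (* Here [2 * rad i <= 4 * rad j], and [y] is within [rad j] of the centre of the selected cube:
     hence the factor [5]. *)
  have : `|x - y| <= 2 * rad i.
    by rewrite (le_trans (ler_distD (ctr i) _ _))// (distrC _ y); lra.
  lra.
apply: (le_trans (le_outer_measure mu _ _ GF5)).
apply: (le_trans (outer_measure_sigma_subadditive mu F5)).
apply: (@le_trans _ _ (\sum_(k <oo) C%:E * mu (F k))%E).
  by apply: lee_nneseries => k *; [exact: outer_measure_ge0|exact: F5F].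
rewrite nneseriesZl; last by move=> *; exact: outer_measure_ge0.
have -> : (\sum_(k <oo) mu (F k) = mu (\bigcup_k F k))%E.
  apply/esym; apply: (measure_semi_bigcup (lebesgue n)) => //.
  by apply: bigcupT_measurable => k; exact: mF.
apply: (@le_trans _ _ (C%:E * (e / C)%:E)%E).
  rewrite lee_wpmul2l ?lee_fin ?(ltW C0)//.
  apply: (le_trans _ UE); apply: le_outer_measure => x [k _]; rewrite /F.
  case: pickle_inv => // i; case: ifPn => // /set_mem/SD[_ QU _] [xi nEx].
  by split => //; exact: QU.
by rewrite -EFinM mulrC divfK// gt_eqF.
Qed.

(** Failures are sorted by the proportion [1 / (k + 1)] of the ball that is missed, and by a bound
    [m] on the norm, which makes each class of finite measure. *)
Lemma lebesgue_density E : lmeasurable E -> mu [set x | E x /\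
  ~ forall e : R, 0 < e -> exists2 d : R, 0 < d & forall r, 0 < r < d ->
    (mu (eball x r `\` E) <= e%:E * mu (eball x r))%E] = 0%E.
Proof.
move=> mE.
pose G (k m : nat) := [set x | [/\ E x, `|x| <= m%:R &
  forall d : R, 0 < d -> exists r : R, 0 < r < d /\
    (k.+1%:R^-1%:E * mu (eball x r) <= mu (eball x r `\` E))%E]].
have G0 k : mu (\bigcup_m G k m) = 0%E.
  apply: lebesgue_null_bigcup => m.
  apply: (vitali_null (E := E) (eps := k.+1%:R^-1)) => //.
  - by move=> x [].
  - apply: le_lt_trans (lebesgue_cube_lty 0 m%:R).
    by apply: le_outer_measure => x [_ + _]; rewrite /= subr0.
  - by move=> x [].
apply: lebesgue_null_sub (lebesgue_null_bigcup G0) => x [Ex /existsNP[e]].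
move=> /not_implyP[e0 /forall2NP ne].
have /ltr_add_invr[k] := e0; rewrite add0r => ke.
exists k => //; exists (Num.truncn `|x|).+1 => //; split => //.
  by rewrite ltW// truncnS_gt.
move=> d d0; have [//|/existsNP[r /not_implyP[rd /negP]]] := ne d.
rewrite -ltNge => /ltW er; exists r; split => //; apply: le_trans er.
by rewrite lee_wpmul2r ?outer_measure_ge0// lee_fin ltW.
Qed.

(** If one ball were null, so would be a cube inside it, by scaling every cube, and finally the
    whole space. *)
Lemma lebesgue_eball_gt0 x (r : R) : (0 < mu setT)%E -> 0 < r ->
  (0 < mu (eball x r))%E.
Proof.
move=> T0 r0; rewrite lt0e outer_measure_ge0 andbT; apply/eqP => xr0.
have s0 : 0 < r / n.+1%:R by rewrite divr_gt0.
have cube0 : mu (cube x (r / n.+1%:R)) = 0%E.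
  by apply: lebesgue_null_sub xr0; exact: cube_sub_eball.
suff : mu setT = 0%E by move=> T00; rewrite T00 ltxx in T0.
have k0 (k : nat) : mu (cube 0 k.+1%:R) = 0%E.
  apply/eqP; rewrite eq_le outer_measure_ge0 andbT.
  rewrite -(divfK (lt0r_neq0 s0) k.+1%:R).
  rewrite (le_trans (lebesgue_cube_le x _ _ _)) ?divr_gt0//.
  by rewrite cube0 mule0.
apply: lebesgue_null_sub (lebesgue_null_bigcup k0) => y _.
by exists (Num.truncn `|y|) => //=; rewrite /cube/= subr0 ltW// truncnS_gt.
Qed.

Lemma lmeasurable_eball x (r : R) : lmeasurable (eball x r).
Proof. exact/lmeasurable_closed/closed_eball. Qed.

Lemma eball_splitP E x (r : R) : (0 < mu setT)%E -> lmeasurable E -> 0 < r ->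
  exists a b : R, [/\ 0 <= a, 0 <= b, 0 < a + b /\ mu (eball x r) = (a + b)%:E,
    mu (E `&` eball x r) = a%:E /\ mu (eball x r `\` E) = b%:E &
    (lebesgue n (E `&` eball x r) * (lebesgue n (eball x r))^-1)%E =
    (a / (a + b))%:E].
Proof.
move=> T0 mE r0; have b0 := lebesgue_eball_gt0 x T0 r0.
have boo := eball_lty x r.
have fin (A : set 'rV[R]_n) : A `<=` eball x r -> mu A \is a fin_num.
  move=> Ab; rewrite ge0_fin_numE ?outer_measure_ge0//.
  by apply: le_lt_trans boo; exact: le_outer_measure.
have split_b : mu (eball x r) = (mu (eball x r `\` E) + mu (E `&` eball x r))%E.
  by rewrite setIC; exact: (measureDI (lebesgue n) (lmeasurable_eball x r) mE).
have Ifin : mu (E `&` eball x r) = (fine (mu (E `&` eball x r)))%:E.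
  by rewrite fineK// fin//; exact: subIsetr.
have Dfin : mu (eball x r `\` E) = (fine (mu (eball x r `\` E)))%:E.
  by rewrite fineK// fin//; exact: subDsetl.
exists (fine (mu (E `&` eball x r))), (fine (mu (eball x r `\` E))).
have bE : mu (eball x r) = (fine (mu (E `&` eball x r)) +
    fine (mu (eball x r `\` E)))%:E.
  by rewrite split_b {1}Dfin {1}Ifin -EFinD addrC.
have ab0 : 0 < fine (mu (E `&` eball x r)) + fine (mu (eball x r `\` E)).
  by rewrite -lte_fin -bE.
split => //; do ?[by rewrite fine_ge0// outer_measure_ge0].
rewrite -[lebesgue n _]/(mu _) -[lebesgue n (eball x r)]/(mu (eball x r)).
rewrite bE inver gt_eqF//.
by rewrite {1}Ifin -EFinM.
Qed.

Lemma ae_density_points E : (0 < mu setT)%E -> lmeasurable E ->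
  mu [set x | E x /\ ~ density_points E x] = 0%E.
Proof.
move=> T0 mE; apply: lebesgue_null_sub (lebesgue_density mE) => x [Ex nx].
split => // dx; apply: nx; rewrite /density_points/=.
apply/fine_cvgP; split.
  near=> r; have r0 : 0 < r by near: r; exact: nbhs_right_gt.
  by have [a [b [_ _ _ _ ->]]] := eball_splitP x T0 mE r0.
apply/cvgrPdist_le => e e0; have [d d0 dE] := dx e e0.
near=> r; have r0 : 0 < r by near: r; exact: nbhs_right_gt.
have [a [b [a0 b0 [ab0 bE] [_ DE] /= ->]]] := eball_splitP x T0 mE r0.
have : (mu (eball x r `\` E) <= e%:E * mu (eball x r))%E.
  by apply: dE; apply/andP; split => //; near: r; exact: nbhs_right_lt.
rewrite DE bE -EFinM lee_fin => be /=.
have -> : 1 - a / (a + b) = b / (a + b).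
  by rewrite -{1}(divff (lt0r_neq0 ab0)) -mulrBl addrC addKr.
by rewrite ger0_norm ?divr_ge0 ?(ltW ab0)// ler_pdivrMr.
Unshelve. all: by end_near. Qed.

(** Almost every point outside [E] is a density point of the complement: there [E] fills at most
    [1 / 3] of small balls, against more than [1 / 2] at a density point of [E]. *)
Lemma ae_mem_density_points E : (0 < mu setT)%E -> lmeasurable E ->
  mu [set x | density_points E x /\ ~ E x] = 0%E.
Proof.
move=> T0 mE; have mEC : lmeasurable (~` E) by apply: measurableC; exact: mE.
apply: lebesgue_null_sub (lebesgue_density mEC) => x [dx nEx].
split => // /(_ 3^-1)[|d d0 dE]; first by rewrite invr_gt0.
move: dx; rewrite /density_points/= => /fine_cvgP[_ dx].
have half : (2^-1 : R) < 1 by rewrite invf_lt1// ltr1n.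
have {dx}dx := cvgr_gt _ dx _ half.
have : \forall r \near (0 : R)^'+, False.
  near=> r; have r0 : 0 < r by near: r; exact: nbhs_right_gt.
  have [a [b [a0 b0 [ab0 bE] [aE _] rE]]] := eball_splitP x T0 mE r0.
  have : (mu (eball x r `\` ~` E) <= (3^-1)%:E * mu (eball x r))%E.
    by apply: dE; apply/andP; split => //; near: r; exact: nbhs_right_lt.
  rewrite setDE setCK setIC aE bE -EFinM lee_fin => be.
  have : 2^-1 < (a / (a + b)).
    rewrite -[X in _ < X]/(fine (a / (a + b))%:E) -rE.
    near: r; exact: dx.
  rewrite ltr_pdivlMr// => a2.
  clear -be a2 ab0; lra.
by move=> /filter_ex[].
Unshelve. all: by end_near. Qed.

End density.

(** * Rearrangements *)

Section essential.
Context {R : realType} {n : nat}.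
Local Notation mu := (@lebesgue_outer R n).
Implicit Types (A B C : set 'rV[R]_n) (f g : 'rV[R]_n -> R).

Lemma ess_subsetP A B : ess_subset A B <-> mu (A `\` B) = 0%E.
Proof. exact: negligible_lebesgueP. Qed.

Lemma subset_ess A B : A `<=` B -> ess_subset A B.
Proof.
move=> AB; apply/ess_subsetP; rewrite (_ : A `\` B = set0) ?outer_measure0//.
by rewrite setD_eq0.
Qed.

Lemma ess_subset_trans A B C :
  ess_subset A B -> ess_subset B C -> ess_subset A C.
Proof.
move=> /ess_subsetP AB /ess_subsetP BC; apply/ess_subsetP.
apply: (@lebesgue_null_sub _ _ _ ((A `\` B) `|` (B `\` C))).
  by move=> x [Ax nCx]; have [Bx|nBx] := pselect (B x); [right|left].
apply/eqP; rewrite eq_le outer_measure_ge0 andbT.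
by rewrite (le_trans (lebesgue_outerU2 _ _))// AB BC adde0.
Qed.

Lemma ess_leP f g : ess_le f g <-> mu [set x | g x < f x] = 0%E.
Proof.
rewrite -negligible_lebesgueP.
by split; apply: negligibleS => x /=; rewrite ltNge => /negP.
Qed.

Lemma le_ess_le f g : (forall x, f x <= g x) -> ess_le f g.
Proof.
move=> fg; apply/ess_leP; rewrite (_ : mkset _ = set0) ?outer_measure0//.
by apply/seteqP; split => // x /=; rewrite ltNge fg.
Qed.

Lemma ess_le_superlevel f g (t : R) : ess_le f g ->
  ess_subset [set x | t < f x] [set x | t < g x].
Proof.
move=> /ess_leP fg; apply/ess_subsetP; apply: lebesgue_null_sub fg.
by move=> x [/= tf /negP]; rewrite -leNgt => /le_lt_trans; exact.
Qed.

Lemma ess_subset_le A B : ess_subset A B -> (mu A <= mu B)%E.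
Proof.
move=> /ess_subsetP AB.
apply: (@le_trans _ _ (mu (B `|` (A `\` B)))).
  by apply: le_outer_measure => x Ax; have [|] := pselect (B x); [left|right].
by rewrite (le_trans (lebesgue_outerU2 _ _))// AB adde0.
Qed.

(** When measures are finite, an essential inclusion with no gain in measure is an equality. Through
    this lemma equimeasurability reverses the inclusions that monotonicity of [T] provides. *)
Lemma ess_subset_sym A B : lmeasurable A -> lmeasurable B ->
  ess_subset A B -> (mu B <= mu A)%E -> (mu B < +oo)%E -> ess_subset B A.
Proof.
move=> mA mB AB BA Boo; apply/ess_subsetP/lebesgue_null_eps => e e0.
have -> : B `\` A = B `\` (A `&` B) by rewrite setDIr setDv setU0.
apply: lebesgue_setD_le => //.
- by apply: measurableI; [exact: mA|exact: mB].
- by apply: le_lt_trans Boo; apply: le_outer_measure; exact: subIsetr.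
- rewrite (le_trans BA)// (le_trans (ess_subset_le (B := A `&` B) _))//.
    by apply/ess_subsetP; rewrite setDIr setDv set0U; exact/ess_subsetP.
  by rewrite leeDl// lee_fin ltW.
Qed.

Lemma lmeasurable_superlevel f (t : R) : lmeasurable_fun f ->
  lmeasurable [set x | t < f x].
Proof.
move=> mf; have := mf measurableT _ (measurable_itv `]t, +oo[).
by rewrite setTI preimage_itvoy.
Qed.

End essential.

(** * The spaces S and V *)

Section function_spaces.
Context {R : realType} {n : nat}.
Local Notation mu := (@lebesgue_outer R n).
Implicit Types (A B : set 'rV[R]_n) (f g : 'rV[R]_n -> R).
Variable X : set ('rV[R]_n -> R).
Hypothesis XSV : X = spaceS \/ X = spaceV.

Lemma space_measurable f : X f -> lmeasurable_fun f.
Proof. by case: XSV => -> []. Qed.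

(** Such a level is at most the essential infimum in [spaceS], and at most [0] in [spaceV]. *)
Lemma space_superlevel_infty f (t : R) : X f -> mu [set x | t < f x] = +oo%E ->
  mu [set x | f x < t] = 0%E.
Proof.
case: XSV => ->.
  move=> [_ Sf] foo; have : (t%:E <= ess_inf (lebesgue n) (fun x => (f x)%:E))%E.
    by rewrite leNgt; apply/negP => /Sf; rewrite [X in (X < _)%E]foo.
  move=> /ess_infP tf; apply/negligible_lebesgueP; apply: negligibleS tf => x /=.
  by rewrite lee_fin => xt /(lt_le_trans xt); rewrite ltxx.
move=> [_ f0 Vf] foo; have t0 : t <= 0.
  by rewrite leNgt; apply/negP => /Vf; rewrite [X in (X < _)%E]foo.
rewrite (_ : mkset _ = set0) ?outer_measure0//.
apply/seteqP; split => // x /= /lt_le_trans/(_ t0).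
by rewrite ltNge f0.
Qed.

Lemma space_of_support f B (c : R) : lmeasurable_fun f -> (mu B < +oo)%E ->
  (forall x, c <= f x) -> (forall x, ~ B x -> f x <= c) ->
  c <= 0 -> (X = spaceV -> 0 <= c) -> X f.
Proof.
move=> mf Boo cf fc c0 cV.
have foo (t : R) : c <= t -> (mu [set x | (t < f x)%R] < +oo)%E.
  move=> ct; apply: le_lt_trans Boo; apply: le_outer_measure => x /= tx.
  by apply: contrapT => /fc; rewrite leNgt (le_lt_trans ct tx).
case: XSV => XE; rewrite XE; split => //.
- move=> t inft; apply: foo; rewrite -lee_fin; apply: le_trans (ltW inft).
  apply/ess_infP; apply: nearW => x; rewrite lee_fin; exact: cf.
- by move=> x; apply: le_trans (cf x); exact: cV.
- by move=> t /ltW/(le_trans c0)/foo.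
Qed.

Lemma space_max f g : X f -> X g -> X (fun x => Num.max (f x) (g x)).
Proof.
move=> Xf Xg.
have mmax : lmeasurable_fun (fun x => Num.max (f x) (g x)).
  by apply: measurable_maxr; exact: space_measurable.
have sub (t : R) : [set x | t < Num.max (f x) (g x)] `<=`
    [set x | t < f x] `|` [set x | t < g x].
  by move=> x /=; rewrite lt_max => /orP.
have maxoo (t : R) : (mu [set x | (t < f x)%R] < +oo)%E ->
    (mu [set x | (t < g x)%R] < +oo)%E ->
    (mu [set x | (t < Num.max (f x) (g x))%R] < +oo)%E.
  move=> foo goo; apply: (le_lt_trans (le_outer_measure mu _ _ (sub t))).
  by apply: (le_lt_trans (lebesgue_outerU2 _ _)); exact: lte_add_pinfty.
move: Xf Xg; case: XSV => ->.
  move=> [mf Sf] [mg Sg]; split => // t tinf; apply: maxoo; [apply: Sf|apply: Sg];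
    apply: le_lt_trans tinf; apply: le_ess_inf; apply: nearW => x;
    by rewrite lee_fin le_max lexx ?orbT.
move=> [mf f0 Vf] [mg g0 Vg]; split => //.
  by move=> x; rewrite le_max f0.
by move=> t t0; apply: maxoo; [exact: Vf|exact: Vg].
Qed.

End function_spaces.

Section rearrangement.
Context {R : realType} {n : nat}.
Local Notation mu := (@lebesgue_outer R n).
Implicit Types (A B : set 'rV[R]_n) (f g : 'rV[R]_n -> R).
Variables (X : set ('rV[R]_n -> R)) (T : ('rV[R]_n -> R) -> ('rV[R]_n -> R)).
Hypotheses (XSV : X = spaceS \/ X = spaceV) (TX : rearrangement X T).

Lemma rearrangement_space f : X f -> X (T f).
Proof. by case: TX => + _ _; exact. Qed.

Lemma rearrangement_equimeasurable f (t : R) : X f ->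
  mu [set x | t < T f x] = mu [set x | t < f x].
Proof. by case: TX => _ + _; exact. Qed.

Lemma rearrangement_monotone f g (t : R) : X f -> X g ->
  (forall x, f x <= g x) ->
  ess_subset [set x | t < T f x] [set x | t < T g x].
Proof.
move=> Xf Xg fg; apply: ess_le_superlevel; case: TX => _ _; apply => //.
exact: le_ess_le.
Qed.

Lemma lmeasurable_rearrangement_superlevel f (t : R) : X f ->
  lmeasurable [set x | t < T f x].
Proof.
by move=> Xf; apply/lmeasurable_superlevel/(space_measurable XSV)/rearrangement_space.
Qed.

Lemma rearrangement_antitone f g (t : R) : X f -> X g ->
  (forall x, g x <= f x) ->
  (mu [set x | (t < f x)%R] <= mu [set x | (t < g x)%R])%E ->
  (mu [set x | (t < f x)%R] < +oo)%E ->
  ess_subset [set x | t < T f x] [set x | t < T g x].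
Proof.
move=> Xf Xg gf mfg foo; apply: ess_subset_sym.
- exact: lmeasurable_rearrangement_superlevel.
- exact: lmeasurable_rearrangement_superlevel.
- exact: rearrangement_monotone.
- by rewrite !rearrangement_equimeasurable.
- by rewrite rearrangement_equimeasurable.
Qed.

(** If [f] has essentially no values in [(s, t]], then neither has [T f]: its two nested superlevel
    sets have equal finite measure. *)
Lemma rearrangement_level_gap f (s t : R) : X f -> s <= t ->
  (mu [set x | (s < f x)%R] <= mu [set x | (t < f x)%R])%E ->
  (mu [set x | (s < f x)%R] < +oo)%E ->
  ess_subset [set x | s < T f x] [set x | t < T f x].
Proof.
move=> Xf st mst foo; apply: ess_subset_sym.
- exact: lmeasurable_rearrangement_superlevel.
- exact: lmeasurable_rearrangement_superlevel.
- by apply: subset_ess => x /=; exact: le_lt_trans.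
- by rewrite !rearrangement_equimeasurable.
- by rewrite rearrangement_equimeasurable.
Qed.

(** Indicators, their multiples ([c = 0]) and the function equal to [M] on [B] and to [min s 0]
    elsewhere are all of this form. *)
Definition step (c M : R) B : 'rV[R]_n -> R := fun x => c + (M - c) * \1_B x.

Lemma step_in c M B x : B x -> step c M B x = M.
Proof. by move=> Bx; rewrite /step indicE mem_set// mulr1 addrC subrK. Qed.

Lemma step_out c M B x : ~ B x -> step c M B x = c.
Proof. by move=> Bx; rewrite /step indicE memNset// mulr0 addr0. Qed.

Lemma step_superlevel c M B (t : R) : c <= t -> t < M ->
  [set x | t < step c M B x] = B.
Proof.
move=> ct tM; apply/seteqP; split => x /=.
  by apply: contraPP => /(step_out c M)->; rewrite ltNge ct.
by move=> /(step_in c M)->.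
Qed.

Lemma space_step c M B : lmeasurable B -> (mu B < +oo)%E -> c <= M -> c <= 0 ->
  (X = spaceV -> 0 <= c) -> X (step c M B).
Proof.
move=> mB Boo cM c0 cV; apply: (space_of_support XSV (B := B) (c := c)) => //.
- apply: measurable_funD; first exact: measurable_cst.
  apply: measurable_funM; first exact: measurable_cst.
  by apply: measurable_indic; exact: mB.
- by move=> x; have [/(step_in c M)->|/(step_out c M)->] := pselect (B x).
- by move=> x /(step_out c M)->.
Qed.

Lemma indic_step B : \1_B = step 0 1 B.
Proof. by apply/funext => x; rewrite /step subr0 mul1r add0r. Qed.

Lemma space_indic B : lmeasurable B -> (mu B < +oo)%E -> X \1_B.
Proof. by move=> mB Boo; rewrite indic_step; apply: space_step. Qed.

(* The chain [1_B <= M 1_B >= g <= max f g >= f], where [g] is [M] on [B] and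
   [min s 0] elsewhere: along each inequality a superlevel set of the smaller
   function has the measure of the larger one's, so that their images under
   [T] essentially coincide. *)
Lemma rearrangement_indic_superlevel f B (s : R) : X f -> lmeasurable B ->
  (mu B < +oo)%E -> ess_subset B [set x | s < f x] ->
  (mu [set x | (s < f x)%R] < +oo)%E ->
  ess_subset [set x | 0 < T \1_B x] [set x | s < T f x].
Proof.
move=> Xf mB Boo Bf foo.
(* A negative level in [spaceV] is exceeded everywhere by [T f >= 0]. Once it is excluded, the base
   value [c] below is admissible in both spaces. *)
have [sV|nsV] := pselect (X = spaceV -> 0 <= s); last first.
  have [XV /negP] : X = spaceV /\ ~ 0 <= s by apply/not_implyP.
  rewrite -ltNge => s0; apply: subset_ess => x _ /=.
  have := rearrangement_space Xf; rewrite XV => -[_ + _] => /(_ x).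
  exact: lt_le_trans.
(* The level [|s|] is at least [0], [s] and [c] and lies below [M], so both step functions have
   superlevel set [B] there; [M >= 1] gives [1_B <= M 1_B]. *)
pose c := Num.min s 0; pose M := `|s| + 1.
have s0 := normr_ge0 s; have sM : `|s| < M by rewrite ltrDl.
have cs : c <= s by rewrite ge_min lexx.
have c0 : c <= 0 by rewrite ge_min lexx orbT.
have ss := ler_norm s.
have M1 : 1 <= M by rewrite lerDr.
have XM : X (step 0 M B) by apply: space_step => //; lra.
have Xg : X (step c M B).
  apply: space_step => //; first lra.
  by move=> XV; rewrite le_min lexx sV.
have Xh := space_max XSV Xf Xg.
apply: (@ess_subset_trans _ _ _ [set x | 0 < T (step 0 M B) x]).
  rewrite indic_step; apply: rearrangement_monotone => // [|x].
    by apply: space_step.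
  by have [Bx|Bx] := pselect (B x);
    [rewrite !(step_in _ _ Bx)|rewrite !(step_out _ _ Bx)].
apply: (@ess_subset_trans _ _ _ [set x | `|s| < T (step 0 M B) x]).
  by apply: rearrangement_level_gap => //; rewrite !step_superlevel//; lra.
apply: (@ess_subset_trans _ _ _ [set x | `|s| < T (step c M B) x]).
  apply: rearrangement_antitone => //; last 2 first.
  - by rewrite !step_superlevel//; lra.
  - by rewrite !step_superlevel//; lra.
  - by move=> x; have [Bx|Bx] := pselect (B x);
      [rewrite !(step_in _ _ Bx)|rewrite !(step_out _ _ Bx)].
apply: (@ess_subset_trans _ _ _ [set x | s < T (step c M B) x]).
  by apply: subset_ess => x /=; exact: le_lt_trans.
apply: (@ess_subset_trans _ _ _
    [set x | s < T (fun x => Num.max (f x) (step c M B x)) x]).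
  by apply: rearrangement_monotone => // x; rewrite le_max lexx orbT.
have hf : (mu [set x | (s < Num.max (f x) (step c M B x))%R] <=
    mu [set x | (s < f x)%R])%E.
  apply: ess_subset_le; apply/ess_subsetP.
  move/ess_subsetP: Bf; apply: lebesgue_null_sub => x [/= + nfx].
  rewrite lt_max => /orP[//|sg]; split => //.
  by apply: contrapT => Bx; move: sg; rewrite step_out// ltNge cs.
apply: rearrangement_antitone => //.
  by move=> x; rewrite le_max lexx.
exact: le_lt_trans foo.
Qed.

Lemma diamond_sub B : diamond T B `<=` [set x | 0 < T \1_B x].
Proof. by move=> x /= ->. Qed.

(** The superlevel sets of [1_B] agree at all levels in [[0, 1)] and are empty at [1], so [T 1_B]
    has essentially no values in [(0, 1)] or above [1]. *)
Lemma superlevel_sub_diamond B : lmeasurable B -> (mu B < +oo)%E ->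
  ess_subset [set x | 0 < T \1_B x] (diamond T B).
Proof.
move=> mB Boo; have X1 := space_indic mB Boo.
have gap (k : nat) : mu ([set x | 0 < T \1_B x] `\`
    [set x | 1 - k.+1%:R^-1 < T \1_B x]) = 0%E.
  have k1 : k.+1%:R^-1 <= 1 :> R by rewrite invf_le1// ler1n.
  have k0 : 0 < k.+1%:R^-1 :> R by [].
  apply/ess_subsetP; apply: rearrangement_level_gap => //.
  - by rewrite subr_ge0.
  - by rewrite indic_step !step_superlevel// ?subr_ge0// ltrBlDr ltrDl.
  - by rewrite indic_step step_superlevel.
have top : mu [set x | 1 < T \1_B x] = 0%E.
  rewrite rearrangement_equimeasurable// (_ : mkset _ = set0) ?outer_measure0//.
  apply/seteqP; split => // x /=.
  by rewrite indicE; case: (x \in B); rewrite ?ltxx// ltr10.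
apply/ess_subsetP.
apply: (@lebesgue_null_sub _ _ _ (\bigcup_k ([set x | 0 < T \1_B x] `\`
    [set x | 1 - k.+1%:R^-1 < T \1_B x]) `|` [set x | 1 < T \1_B x])); last first.
  apply/eqP; rewrite eq_le outer_measure_ge0 andbT.
  by rewrite (le_trans (lebesgue_outerU2 _ _))// top adde0 lebesgue_null_bigcup.
move=> x [/= T0 T1]; have [|T1'] := ltP 1 (T \1_B x); first by right.
left; have /ltr_add_invr[k Tk] : T \1_B x < 1.
  by rewrite lt_neqAle T1' andbT; exact/eqP.
exists k => //; split => //=; rewrite ltrBlDr => /lt_trans/(_ Tk).
by rewrite ltxx.
Qed.

Lemma lmeasurable_diamond B : lmeasurable B -> (mu B < +oo)%E ->
  lmeasurable (diamond T B).
Proof.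
move=> mB Boo.
have mT : lmeasurable_fun (T \1_B).
  exact/(space_measurable XSV)/rearrangement_space/space_indic.
by have := mT measurableT _ (measurable_set1 1); rewrite setTI.
Qed.

Lemma le_lebesgue_diamond B : lmeasurable B -> (mu B < +oo)%E ->
  (mu B <= mu (diamond T B))%E.
Proof.
move=> mB Boo; apply: le_trans (ess_subset_le (superlevel_sub_diamond mB Boo)).
rewrite rearrangement_equimeasurable; last exact: space_indic.
by rewrite indic_step step_superlevel.
Qed.

End rearrangement.

(** * Convex bodies and gauges *)

Section dilates.
Context {R : realType} {n : nat}.
Implicit Types (A K L : set 'rV[R]_n) (u : 'rV[R]_n).

(** For [K] convex with [0] in its interior and [d > 0], this is the open gauge ball of radius [d],
    written without an infimum. *)
Definition odilate (d : R) K : set 'rV[R]_n :=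
  [set u | exists2 l : R, 0 < l < d & dilate l K u].

Lemma dilateS (l : R) A K : A `<=` K -> dilate l A `<=` dilate l K.
Proof. by move=> AK _ [x /AK Kx <-]; exists x. Qed.

Lemma dilate_dilate (l m : R) K : dilate l (dilate m K) = dilate (l * m) K.
Proof.
apply/seteqP; split => [_ [_ [x Kx <-] <-]|_ [x Kx <-]].
  by exists x; rewrite ?scalerA.
by exists (m *: x); [exists x|rewrite scalerA].
Qed.

Lemma dilateP (l : R) K u : 0 < l -> dilate l K u <-> K (l^-1 *: u).
Proof.
move=> l0; split => [[x Kx <-]|Ku].
  by rewrite scalerA mulVf ?gt_eqF// scale1r.
by exists (l^-1 *: u) => //; rewrite scalerA divff ?gt_eqF// scale1r.
Qed.

Lemma convex_set_combination K (l : R) x y : convex_set K -> 0 <= l <= 1 ->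
  K x -> K y -> K (l *: x + (1 - l) *: y).
Proof.
move=> cK l01 Kx Ky.
have /andP[l0 l1] := l01.
by have := cK x y (Itv01 l0 l1) (mem_set Kx) (mem_set Ky) => /set_mem.
Qed.

Lemma convex_dilate_le K (l m : R) : convex_set K -> K 0 -> 0 <= l <= m ->
  dilate l K `<=` dilate m K.
Proof.
move=> cK K0 /andP[l0 lm] _ [x Kx <-].
have [m0|m0] := eqVneq m 0.
  have -> : l = m by apply/eqP; rewrite eq_le lm m0.
  by exists x.
have m_gt0 : 0 < m by rewrite lt_def m0 (le_trans l0 lm).
exists ((l / m) *: x); last by rewrite scalerA mulrC divfK.
rewrite -[X in K X]addr0 -[X in _ + X](scaler0 _ (1 - l / m)).
apply: convex_set_combination => //.
by rewrite divr_ge0 ?(ltW m_gt0)//= ler_pdivrMr// mul1r.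
Qed.

Lemma interior0_ball K : interior K 0 ->
  exists2 e : R, 0 < e & forall u, `|u| < e -> K u.
Proof.
move=> /nbhs_ballP[e/= e0 eK]; exists e => // u ue; apply: eK.
by rewrite -ball_normE/= sub0r normrN.
Qed.

(** By convexity [l K + m K] lies in [(l + m) K]. With [m] half of [d - l], a ball of radius [e] in
    [K] yields the margin [m * e]. *)
Lemma odilate_margin K (l d : R) : convex_set K -> interior K 0 ->
  0 < l < d -> exists2 e : R, 0 < e &
    forall k u, dilate l K k -> `|u| < e -> odilate d K (k + u).
Proof.
move=> cK /interior0_ball[e e0 eK] /andP[l0 ld].
pose m := (d - l) / 2; have m0 : 0 < m by rewrite divr_gt0// subr_gt0.
exists (m * e); first exact: mulr_gt0.
move=> _ u [x Kx <-] ue.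
have lm0 : 0 < l + m by rewrite addr_gt0.
exists (l + m); first by apply/andP; split => //; rewrite /m; lra.
exists ((l / (l + m)) *: x + (1 - l / (l + m)) *: (m^-1 *: u)).
  apply: convex_set_combination => //.
    rewrite divr_ge0 ?(ltW l0) ?(ltW lm0)//= ler_pdivrMr// mul1r lerDl.
    exact: ltW.
  apply: eK; rewrite normrZ gtr0_norm ?invr_gt0//.
  by rewrite mulrC ltr_pdivrMr// mulrC.
rewrite scalerDr !scalerA mulrCA divff ?gt_eqF// mulr1; congr (_ + _).
have -> : (l + m) * (1 - l / (l + m)) = m.
  by rewrite mulrBr mulr1 mulrCA divff ?gt_eqF// mulr1 addrC addKr.
by rewrite divff ?gt_eqF// scale1r.
Qed.

Lemma o_symmetric_dilate K (l : R) u : o_symmetric K ->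
  dilate l K u -> dilate l K (- u).
Proof.
move=> sK [x Kx <-]; exists (- x); last by rewrite scalerN.
by rewrite -sK; exists x.
Qed.

Lemma odilateN K (d : R) u : o_symmetric K -> odilate d K u -> odilate d K (- u).
Proof. by move=> sK [l ld lu]; exists l => //; exact: o_symmetric_dilate. Qed.

Lemma odilateS (d : R) A K : A `<=` K -> odilate d A `<=` odilate d K.
Proof. by move=> AK u [l ld lu]; exists l => //; exact: dilateS lu. Qed.

Lemma gauge_odilate K (d : R) u : odilate d K u -> gauge K u <= d.
Proof.
move=> [l /andP[l0 ld] lu]; apply: le_trans (ltW ld).
apply: ge_inf; first by exists 0 => x [].
by split => //; exact: ltW.
Qed.

(** For each [e > 0] the point [u / (d + e)] lies in [K]; closedness of [K] allows [e] to tend to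
    [0]. *)
Lemma gauge_le_dilate K (d : R) u : convex_set K -> closed K ->
  interior K 0 -> 0 < d -> gauge K u <= d -> dilate d K u.
Proof.
move=> cK clK K0 d0 gud.
have KO : K 0 by exact: interior_subset.
have dK (e : R) : 0 < e -> K ((d + e)^-1 *: u).
  move=> e0; apply/dilateP; first exact: addr_gt0.
  have [||l [l0 lu] le] := @inf_lt _ [set l : R | 0 <= l /\ dilate l K u] (d + e).
  - have [r r0 rK] := interior0_ball K0.
    exists ((`|u| + 1) / r); split; first by rewrite divr_ge0 ?addr_ge0 ?(ltW r0).
    apply/dilateP; first by rewrite divr_gt0// ltr_wpDl.
    apply: rK; rewrite normrZ gtr0_norm ?invr_gt0 ?divr_gt0 ?ltr_wpDl//.
    rewrite invf_div mulrAC ltr_pdivrMr ?ltr_wpDl// ltr_pM2l//.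
    by rewrite ltrDl.
  - by rewrite (le_lt_trans gud)// ltrDl.
  by apply: convex_dilate_le lu => //; rewrite l0 ltW.
apply/dilateP => //.
apply: (@closed_cvg _ _ (0 : R)^'+ _ (fun e => (d + e)^-1 *: u) K clK).
  by near=> e; apply: dK; near: e; exact: nbhs_right_gt.
apply: cvg_at_right_filter; rewrite -[X in X^-1]addr0; apply: cvgZr_tmp.
apply: cvgV; first by rewrite addr0 gt_eqF.
by apply: cvgD; [exact: cvg_cst|exact: cvg_id].
Unshelve. all: by end_near. Qed.

(** Convexity of the square, applied to each coordinate, replaces the triangle inequality for
    [enorm]. *)
Lemma convex_unit_ball : convex_set (unit_ball : set 'rV[R]_n).
Proof.
have ballP (x : 'rV[R]_n) : unit_ball x <-> \sum_i x ord0 i ^+ 2 <= 1.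
  rewrite /unit_ball/eball/= subr0 /enorm -[X in _ <= X]sqrtr1.
  by rewrite ler_sqrt.
move=> x y l /set_mem/ballP x1 /set_mem/ballP y1; apply/mem_set/ballP.
have -> : conv l x y = l%:num *: x + (1 - l%:num) *: y by [].
have l0 : 0 <= l%:num by [].
have l1 : l%:num <= 1 by [].
move: (l%:num) l0 l1 => t t0 t1.
apply: (@le_trans _ _ (t * (\sum_i x ord0 i ^+ 2) + (1 - t) * (\sum_i y ord0 i ^+ 2))).
  rewrite !mulr_sumr -big_split/=; apply: ler_sum => i _; rewrite !mxE.
  move: (x ord0 i) (y ord0 i) => p q; rewrite -subr_ge0.
  have -> : t * p ^+ 2 + (1 - t) * q ^+ 2 - (t * p + (1 - t) * q) ^+ 2 =
    t * (1 - t) * (p - q) ^+ 2 by ring.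
  by rewrite mulr_ge0 ?sqr_ge0// mulr_ge0// subr_ge0.
rewrite (le_trans (lerD (ler_wpM2l t0 x1) (ler_wpM2l _ y1))) ?subr_ge0//.
by rewrite !mulr1 addrC subrK.
Qed.

Lemma convex_dilate K (l : R) : convex_set K -> convex_set (dilate l K).
Proof.
move=> cK x y t /set_mem[a Ka <-] /set_mem[b Kb <-]; apply/mem_set.
exists (conv t (a : convex_lmodType 'rV[R]_n) (b : convex_lmodType 'rV[R]_n)).
  by apply/set_mem/cK; exact/mem_set.
by rewrite /conv/= scalerDr !scalerA; congr (_ *: _ + _ *: _); rewrite mulrC.
Qed.

Lemma o_symmetric_of_opp K : (forall u, K u -> K (- u)) -> o_symmetric K.
Proof.
move=> KN; apply/seteqP; split => [_ [u Ku <-]|u Ku]; first exact: KN.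
by exists (- u); [exact: KN|rewrite opprK].
Qed.

Lemma ball_dilateP (r : R) u : 0 < r ->
  dilate r unit_ball u <-> enorm u <= r.
Proof.
move=> r0; rewrite dilateP// /unit_ball/eball/= subr0 enormZ ?invr_ge0 ?(ltW r0)//.
by rewrite ler_pdivrMl// mulr1.
Qed.

Lemma interior_ball (r : R) : 0 < r -> interior (dilate r unit_ball : set 'rV[R]_n) 0.
Proof.
move=> r0; apply/nbhs_ballP; exists (r / n.+1%:R) => /=; first by rewrite divr_gt0.
move=> u; rewrite -ball_normE/= sub0r normrN => ur; apply/(ball_dilateP _ r0).
rewrite (le_trans (enorm_le_norm _))// mulrC -ler_pdivlMr//.
exact: ltW.
Qed.

End dilates.

(** * Smoothing rearrangements *)

Section smoothing.
Context {R : realType} {n : nat}.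
Local Notation mu := (@lebesgue_outer R n).
Local Notation mu2 := (@lebesgue_outer R (n + n)).
Variables (X : set ('rV[R]_n -> R)) (T : ('rV[R]_n -> R) -> ('rV[R]_n -> R)).
Hypotheses (XSV : X = spaceS \/ X = spaceV) (TX : rearrangement X T).
Variables (K L : set 'rV[R]_n).
Hypotheses (compactK : compact K) (convexK : convex_set K) (K0 : K 0).
Hypotheses (TK : smoothing K T) (KL : K `<=` L).
Hypotheses (convexL : convex_set L) (L0 : interior L 0) (symL : o_symmetric L).
Hypothesis muT : (0 < mu setT)%E.
Implicit Types (C : set 'rV[R]_n) (f : 'rV[R]_n -> R).

Lemma compact_minkowski_sum (A B : set 'rV[R]_n) : compact A -> compact B ->
  compact (minkowski_sum A B).
Proof.
move=> cA cB; have -> : minkowski_sum A B =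
    (fun p : 'rV[R]_n * 'rV[R]_n => p.1 + p.2) @` (A `*` B).
  apply/seteqP; split => [_ [x Ax [y By <-]]|_ [[x y] [Ax By] <-]].
    by exists (x, y).
  by exists x => //; exists y.
apply: continuous_compact; last exact: compact_setX.
by apply: continuous_subspaceT; exact: add_continuous.
Qed.

(* [C + l K] is covered by countably many translates of the open dilate of
   [L], centred at points of [C] close to the rational ones. *)
Lemma minkowski_sum_superlevel f C (d l r s t : R) : 0 < l < d -> t + r < s ->
  (forall x, C x -> s < f x) ->
  (forall x, C x -> mu [set y | odilate d L (x - y) /\ r < `|f x - f y|] = 0%E) ->
  ess_subset (minkowski_sum C (dilate l K)) [set y | t < f y].
Proof.
move=> ld trs sC nullC; apply/ess_subsetP.
have [e e0 eL] := odilate_margin convexL L0 ld.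
(* [p q] is a point of [C] within [e / 2] of [q] if there is one; otherwise it is [0], and the
   clause [C (p q)] in [F q] guards against this default. *)
have /choice[p pP] : forall q : 'rV[rat]_n, exists x,
    (exists2 c, C c & `|c - map_mx ratr q| < e / 2) ->
    C x /\ `|x - map_mx ratr q| < e / 2.
  move=> q; have [[c Cc cq]|nc] :=
    pselect (exists2 c, C c & `|c - map_mx ratr q| < e / 2); first by exists c.
  by exists 0 => /nc.
pose F q := [set y | C (p q) /\
  (odilate d L (p q - y) /\ r < `|f (p q) - f y|)].
have F0 q : mu (F q) = 0%E.
  have [Cp|nCp] := pselect (C (p q)).
    by apply: lebesgue_null_sub (nullC _ Cp) => y [].
  rewrite (_ : F q = set0) ?outer_measure0//.
  by apply/seteqP; split => // y [].
apply: lebesgue_null_sub (lebesgue_null_countable F0).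
move=> _ [[c Cc [u lu <-]] /= /negP]; rewrite -leNgt => fcu.
have e20 : 0 < e / 2 by rewrite divr_gt0.
have [q cq] := rV_rat_approx c e20.
have [Cp pq] : C (p q) /\ `|p q - map_mx ratr q| < e / 2.
  by apply: pP; exists c.
exists q => //; split => //; split.
  (* By symmetry of [L], [- u] is in [l L]; the error [p q - c] stays below the margin [e]. *)
  rewrite (_ : _ - _ = - u + (p q - c)); last first.
    by rewrite opprD addrA addrC.
  apply: eL; first by apply: (o_symmetric_dilate symL); exact: dilateS lu.
  rewrite (le_lt_trans (ler_distD (map_mx ratr q) _ _))//.
  by rewrite (distrC _ c) [ltRHS]splitr ltrD.
apply: lt_le_trans (ler_norm _).
rewrite ltrBrDr; apply: lt_trans (sC _ Cp); apply: le_lt_trans trs.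
by rewrite addrC lerD2r.
Qed.

(** Smoothing leads to [diamond_star] of [C + l K], the density theorem to its [diamond], and
    comparison of [T f] with the image of an indicator to [T f > t]. *)
Lemma diamond_star_sum_superlevel f C (d l r s t : R) : X f -> 0 < l < d ->
  t + r < s -> (mu [set x | (t < f x)%R] < +oo)%E -> compact C ->
  (forall x, C x -> s < f x) ->
  (forall x, C x -> mu [set y | odilate d L (x - y) /\ r < `|f x - f y|] = 0%E) ->
  ess_subset (minkowski_sum (diamond_star T C) (dilate l K))
    [set y | t < T f y].
Proof.
move=> Xf ld trs foo cC sC nullC.
have bC := compact_bounded cC.
have cB : compact (minkowski_sum C (dilate l K)).
  by apply: compact_minkowski_sum => //; exact: compact_dilate.
have mB := lmeasurable_compact cB.
have Boo := lebesgue_bounded_lty (compact_bounded cB).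
have l0 : 0 < l by have /andP[] := ld.
apply: ess_subset_trans (TK l0 (lmeasurable_compact cC) bC) _.
apply: (@ess_subset_trans _ _ _ (diamond T (minkowski_sum C (dilate l K)))).
  apply/ess_subsetP; apply: ae_mem_density_points => //.
  exact: (lmeasurable_diamond XSV TX).
apply: ess_subset_trans (subset_ess (@diamond_sub _ _ _ _)) _.
apply: (rearrangement_indic_superlevel XSV TX) => //.
exact: (minkowski_sum_superlevel ld trs).
Qed.

(** [diamond T (C k)] lies essentially in [T f > s] and is at least as large as [C k], so it misses
    at most [1 / (k + 1)] of that set, whose measure is that of [f > s]. *)
Lemma superlevel_diamond_star f (s : R) (C : (set 'rV[R]_n)^nat) : X f ->
  (mu [set x | (s < f x)%R] < +oo)%E -> (forall k, compact (C k)) ->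
  (forall k x, C k x -> s < f x) ->
  (forall k, mu ([set x | (s < f x)%R] `\` C k) <= (k.+1%:R^-1)%:E)%E ->
  ess_subset [set x | s < T f x] (\bigcup_k diamond_star T (C k)).
Proof.
move=> Xf foo cC sC mC.
have mCk k := lmeasurable_compact (cC k).
have Coo k := lebesgue_bounded_lty (compact_bounded (cC k)).
have mD k := lmeasurable_diamond XSV TX (mCk k) (Coo k).
have mf := lmeasurable_superlevel s (space_measurable XSV Xf).
have mTf := lmeasurable_rearrangement_superlevel XSV TX s Xf.
have CT k : ess_subset (diamond T (C k)) [set x | s < T f x].
  apply: ess_subset_trans (subset_ess (@diamond_sub _ _ _ _)) _.
  apply: (rearrangement_indic_superlevel XSV TX) => //.
  by apply: subset_ess; exact: sC.
apply: (@ess_subset_trans _ _ _ (\bigcup_k diamond T (C k))); last first.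
  apply/ess_subsetP.
  have H k : mu [set x | diamond T (C k) x /\ ~ density_points (diamond T (C k)) x] = 0%E.
    exact: ae_density_points.
  apply: lebesgue_null_sub (lebesgue_null_bigcup H) => x [[k _ xk] nx].
  by exists k => //; split => // xk'; apply: nx; exists k.
apply/ess_subsetP/lebesgue_null_eps => e e0.
have /ltr_add_invr[k] := e0; rewrite add0r => ke.
apply: (@le_trans _ _ (mu ([set x | (s < T f x)%R] `\`
    ([set x | (s < T f x)%R] `&` diamond T (C k))))).
  apply: le_outer_measure => x [sx nx]; split => // -[_ xk]; apply: nx.
  by exists k.
apply: lebesgue_setD_le => //.
- by apply: measurableI; [exact: mTf|exact: mD].
- apply: (@le_lt_trans _ _ (mu [set x | (s < T f x)%R])).
    by apply: le_outer_measure; exact: subIsetl.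
  by rewrite (rearrangement_equimeasurable TX).
- rewrite (rearrangement_equimeasurable TX)//.
  apply: (@le_trans _ _ (mu (C k) + (k.+1%:R^-1)%:E)%E).
    apply: le_trans (leeD2l _ (mC k)); apply: le_trans (lebesgue_outerU2 _ _).
    by apply: le_outer_measure => x sx; have [|] := pselect (C k x); [left|right].
  rewrite leeD//; last by rewrite lee_fin ltW.
  apply: (le_trans (le_lebesgue_diamond XSV TX (mCk k) (Coo k))).
  apply: ess_subset_le; apply/ess_subsetP; rewrite setDIr setDv setU0.
  exact/ess_subsetP.
Qed.

Section pairs.
Variables (f : 'rV[R]_n -> R) (d r : R).
Hypotheses (Xf : X f) (d0 : 0 < d).
Hypothesis f_close : mu2 [set z | odilate d L (lsubmx z - rsubmx z) /\
  r < `|f (lsubmx z) - f (rsubmx z)|] = 0%E.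

Let far x := [set y | odilate d L (x - y) /\ r < `|f x - f y|].

Lemma ae_far_null : mu [set x | mu (far x) <> 0%E] = 0%E.
Proof.
apply: lebesgue_null_sub (lebesgue_null_sections f_close) => x /=.
rewrite (_ : [set y | _] = far x)//.
by apply/seteqP; split => y; rewrite /far/= row_mxKl row_mxKr.
Qed.

(** For [r < 0] a whole ball about [x] would lie in [far x], which is null for some [x]. The sign
    ensures [t < s] whenever [t + r < s]. *)
Lemma oscillation_ge0 : 0 <= r.
Proof.
have [x x0] : exists x, mu (far x) = 0%E.
  apply/not_existsP => nx; have : mu setT = 0%E.
    by apply: lebesgue_null_sub ae_far_null => x _; exact: nx.
  by move=> T0; move: muT; rewrite T0 ltxx.
rewrite leNgt; apply/negP => r0.
have d2 : 0 < d / 2 < d by rewrite divr_gt0//= gtr_pMr// invf_lt1// ltr1n.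
have [e e0 eL] := odilate_margin convexL L0 d2.
have e20 : 0 < e / 2 by rewrite divr_gt0.
have := lebesgue_eball_gt0 x muT e20.
rewrite (_ : mu (eball x (e / 2)) = 0%E) ?ltxx//.
apply: lebesgue_null_sub x0 => y yx; split; last exact: lt_le_trans r0 _.
rewrite -[_ - _]add0r; apply: eL.
  by exists 0; [exact: interior_subset|rewrite scaler0].
rewrite distrC (le_lt_trans (eball_sub_cube yx))//.
by rewrite gtr_pMr// invf_lt1// ltr1n.
Qed.

Lemma smoothing_levels (s t : R) : t + r < s ->
  mu2 [set z | odilate d K (rsubmx z - lsubmx z) /\
    (s < T f (lsubmx z) /\ T f (rsubmx z) < t)] = 0%E.
Proof.
move=> trs; have XTf := rearrangement_space TX Xf.
(* If [f > t] has infinite measure, so has [T f > t], and then [T f < t] holds only on a null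
   set. *)
have [foo|/eqP] := pselect (mu [set x | t < f x] = +oo%E).
  have Tfoo := space_superlevel_infty XSV XTf (t := t).
  rewrite (rearrangement_equimeasurable TX)// in Tfoo.
  have /(@lebesgue_null_rsub R n n) := Tfoo foo.
  by apply: lebesgue_null_sub => z [_ []].
rewrite -ltey => foo.
have sfoo : (mu [set x | (s < f x)%R] < +oo)%E.
  apply: le_lt_trans foo; apply: le_outer_measure => x /=; apply: lt_trans.
  by apply: le_lt_trans trs; rewrite lerDl oscillation_ge0.
have mf := lmeasurable_superlevel s (space_measurable XSV Xf).
pose A := [set x | s < f x] `\` [set x | mu (far x) <> 0%E].
have mA : lmeasurable A.
  apply: measurableD; first exact: mf.
  exact/lmeasurable_negligible/negligible_lebesgueP/ae_far_null.
have Aoo : (mu A < +oo)%E.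
  by apply: le_lt_trans sfoo; apply: le_outer_measure; exact: subDsetl.
have /choice[C CP] : forall k : nat, exists C,
    [/\ compact C, C `<=` A & (mu (A `\` C) <= (k.+1%:R^-1)%:E)%E].
  by move=> k; exact: lebesgue_inner_regular.
have cC k : compact (C k) by have [] := CP k.
have CA k : C k `<=` A by have [] := CP k.
have Cf k x : C k x -> s < f x by move=> /CA[].
have Cfar k x : C k x -> mu (far x) = 0%E.
  by move=> /CA[_ nx]; apply: contrapT.
pose P := [set x | s < T f x] `\` \bigcup_k diamond_star T (C k).
have P0 : mu P = 0%E.
  apply/ess_subsetP; apply: superlevel_diamond_star => // k.
  apply: (@le_trans _ _ (mu ((A `\` C k) `|` [set x | mu (far x) <> 0%E]))).
    apply: le_outer_measure => x [sx nCx].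
    by have [xf|xf] := pselect (mu (far x) = 0%E); [left; split => //; split|right].
  rewrite (le_trans (lebesgue_outerU2 _ _))// ae_far_null adde0.
  by have [] := CP k.
(* A sequence in [(0, d)] increasing to [d] stands for all factors [m < d]; starting from [j + 2]
   keeps [l 0] positive. *)
pose l (j : nat) := d * (1 - j.+2%:R^-1).
have ld j : 0 < l j < d.
  have j1 : j.+2%:R^-1 < 1 :> R by rewrite invf_lt1// ltr1n.
  have j0 : 0 < j.+2%:R^-1 :> R by [].
  by rewrite /l mulr_gt0 ?subr_gt0//= gtr_pMr// ltrBlDr ltrDl.
pose Q (kj : nat * nat) :=
  minkowski_sum (diamond_star T (C kj.1)) (dilate (l kj.2) K) `\`
  [set y | t < T f y].
have Q0 : mu (\bigcup_kj Q kj) = 0%E.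
  apply: lebesgue_null_countable => -[k j]; apply/ess_subsetP.
  apply: (diamond_star_sum_superlevel Xf (ld j) trs) => //.
  - exact: Cf.
  - exact: Cfar.
(* [P] and the union of the [Q] are the null sets [N1] and [N2]. *)
have := lebesgue_nullU (@lebesgue_null_lsub R n n _ P0)
  (@lebesgue_null_rsub R n n _ Q0).
apply: lebesgue_null_sub => z [[m /andP[m0 md] mu_z] [sz zt]].
have [[k _ kz]|nz] := pselect ((\bigcup_k diamond_star T (C k)) (lsubmx z));
  last by left; split.
right; have : 0 < 1 - m / d by rewrite subr_gt0 ltr_pdivrMr// mul1r.
move=> /ltr_add_invr[j]; rewrite add0r => jm.
exists (k, j) => //; split; last by rewrite /= ltNge (ltW zt).
exists (lsubmx z) => //; exists (rsubmx z - lsubmx z); last by rewrite addrC subrK.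
apply: convex_dilate_le mu_z => //; rewrite (ltW m0)/= /l mulrC -ler_pdivrMr//.
rewrite lerBrDr addrC -lerBrDr ltW//; apply: le_lt_trans jm.
by rewrite lef_pV2 ?posrE// ler_nat.
Qed.

(** A difference above [r] leaves room for rational levels with [T f y < t], [t + r < s] and
    [s < T f x]: countably many null sets suffice. *)
Lemma smoothing_pairs : mu2 [set z | odilate d K (rsubmx z - lsubmx z) /\
  r < T f (lsubmx z) - T f (rsubmx z)] = 0%E.
Proof.
pose F (p : rat * rat) := [set z | ratr p.2 + r < ratr p.1 /\
  (odilate d K (rsubmx z - lsubmx z) /\
  (ratr p.1 < T f (lsubmx z) /\ T f (rsubmx z) < ratr p.2))].
have F0 p : mu2 (F p) = 0%E.
  have [pr|npr] := pselect (ratr p.2 + r < ratr p.1).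
    by apply: lebesgue_null_sub (smoothing_levels pr) => z [].
  by apply: lebesgue_null_sub (outer_measure0 mu2) => z [].
apply: lebesgue_null_sub (lebesgue_null_countable F0) => z [dz rz].
have [|t] := @rat_in_itvoo R (T f (rsubmx z)) (T f (lsubmx z) - r).
  by rewrite ltrBrDr addrC -ltrBrDr.
rewrite in_itv/= => /andP[zt tz].
have [|s] := @rat_in_itvoo R (ratr t + r) (T f (lsubmx z)).
  by rewrite -ltrBrDr.
by rewrite in_itv/= => /andP[ts sz]; exists (s, t).
Qed.

End pairs.

End smoothing.

(** * Bounds on moduli as null-set conditions *)

Section modulus.
Context {R : realType} {n : nat}.
Local Notation mu2 := (@lebesgue_outer R (n + n)).

Lemma modulus_leP (N : 'rV[R]_n -> R) (d r : R) (f : 'rV[R]_n -> R) :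
  (modulus N d f <= r%:E)%E <->
  mu2 [set z | N (lsubmx z - rsubmx z) <= d /\
    r < `|f (lsubmx z) - f (rsubmx z)|] = 0%E.
Proof.
rewrite -negligible_lebesgueP; split.
  move=> /ess_supP; apply: negligibleS => z [Nz rz] /=.
  by rewrite /patch mem_set// lee_fin leNgt rz.
move=> H; apply/ess_supP; apply: negligibleS H => z /=; rewrite /patch.
case: ifPn => [/set_mem Nz|_]; last by rewrite leNye.
by rewrite lee_fin => /negP; rewrite -ltNge.
Qed.

Lemma ereal_le_of_reals (x y : \bar R) :
  (forall r : R, (y <= r%:E)%E -> (x <= r%:E)%E) -> (x <= y)%E.
Proof.
case: y => [r H|_|H]; [exact: H|exact: leey|].
case: x H => [r||] H //; last by have := H 0 (leNye _).
by have := H (r - 1) (leNye _); rewrite lee_fin lerBrDl gerDr ler10.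
Qed.

(* The case of a null [R^n], which does not occur, is kept so as to avoid
   proving that boxes have positive outer measure. *)
Lemma modulus_null (N : 'rV[R]_n -> R) (d : R) (f : 'rV[R]_n -> R) (r : \bar R) :
  @lebesgue_outer R n setT = 0%E -> (modulus N d f <= r)%E.
Proof.
move=> T0; apply: ereal_le_of_reals => t _; apply/modulus_leP.
by apply: lebesgue_null_sub (@lebesgue_null_lsub R n n _ T0).
Qed.

End modulus.

(** The common form of both claims. The bound for pairs is one-sided; the symmetric set [W] inside
    [odilate d K] makes it apply to [(x, y)] and [(y, x)], hence to the absolute value, even if [K]
    is not symmetric. *)
Lemma smoothing_modulus_le (R : realType) (n : nat)
    (X : set ('rV[R]_n -> R)) (T : ('rV[R]_n -> R) -> ('rV[R]_n -> R))
    (K L W : set 'rV[R]_n) (N1 N2 : 'rV[R]_n -> R) (d d1 d2 : R)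
    (f : 'rV[R]_n -> R) :
  X = spaceS \/ X = spaceV -> rearrangement X T ->
  convex_body_o K -> smoothing K T ->
  K `<=` L -> convex_set L -> interior L 0 -> o_symmetric L ->
  0 < d -> X f ->
  (forall u, odilate d L u -> N1 u <= d1) ->
  W `<=` odilate d K -> (forall u, W u -> W (- u)) ->
  @lebesgue_outer R (n + n)
    [set z | N2 (lsubmx z - rsubmx z) <= d2 /\ ~ W (lsubmx z - rsubmx z)] = 0%E ->
  (modulus N2 d2 (T f) <= modulus N1 d1 f)%E.
Proof.
move=> XSV TX [cK convK K0] TK KL convL L0 symL d0 Xf N1L WK symW W0.
have [T0|muT] := pselect (@lebesgue_outer R n setT = 0%E).
  exact: modulus_null.
have {}muT : (0 < @lebesgue_outer R n setT)%E.
  by rewrite lt0e outer_measure_ge0 andbT; exact/eqP.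
apply: ereal_le_of_reals => r /modulus_leP f_r; apply/modulus_leP.
have f_close : @lebesgue_outer R (n + n) [set z |
    odilate d L (lsubmx z - rsubmx z) /\ r < `|f (lsubmx z) - f (rsubmx z)|] = 0%E.
  by apply: lebesgue_null_sub f_r => z [/N1L].
have pairs := smoothing_pairs XSV TX cK convK (interior_subset K0) TK KL convL L0
  symL muT Xf d0 f_close.
apply: lebesgue_null_sub (lebesgue_nullU W0
  (lebesgue_nullU pairs (lebesgue_null_swap pairs))) => z [Nz rz].
have [Wz|nWz] := pselect (W (lsubmx z - rsubmx z)); last by left.
right; move: rz; rewrite ltr_normr => /orP[rz|rz].
  by left; split => //; rewrite -opprB; apply/WK/symW.
by right; rewrite /= row_mxKl row_mxKr; split; [exact: WK|rewrite -opprB].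
Qed.

(** Vectors of [d D] outside [odilate d D] form its radial boundary, so the pairs with such
    differences are null. *)
Lemma closed_convex_boundary (R : realType) (n : nat) (D : set 'rV[R]_n)
    (N : 'rV[R]_n -> R) (d d' : R) :
  closed D -> convex_set D -> D 0 -> 0 < d ->
  (forall u, N u <= d' -> dilate d D u) ->
  lebesgue_outer [set z : 'rV[R]_(n + n) | N (lsubmx z - rsubmx z) <= d' /\
    ~ odilate d D (lsubmx z - rsubmx z)] = 0%E.
Proof.
move=> cD convD D0 d0 ND.
have cdD : closed (dilate d D).
  rewrite (_ : dilate d D = (fun u => d^-1 *: u) @^-1` D).
    by apply: closed_comp cD => u _; exact: continuous_dilate.
  by apply/seteqP; split => u /(dilateP _ _ d0).
have star (l : R) : 0 < l < 1 -> dilate l (dilate d D) `<=` dilate d D.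
  move=> /andP[l0 l1]; rewrite dilate_dilate; apply: convex_dilate_le => //.
  by rewrite mulr_ge0 ?(ltW l0) ?(ltW d0)//= ger_pMl// ltW.
apply: lebesgue_null_sub (ae_radial_boundary cdD star) => z [Nz nz].
split; first exact: ND.
move=> l /andP[l0 l1]; rewrite dilate_dilate => lz; apply: nz.
by exists (l * d) => //; rewrite mulr_gt0//= gtr_pMl.
Qed.

Theorem theorem4p11 (R : realType) (n : nat) (hn : (2 <= n)%N)
    (X : set ('rV[R]_n -> R)) (hX : X = spaceS \/ X = spaceV)
    (K : set 'rV[R]_n) (hK : convex_body_o K)
    (T : ('rV[R]_n -> R) -> ('rV[R]_n -> R))
    (hT : rearrangement X T) (hTK : smoothing K T) :
  (o_symmetric K ->
     forall (d : R) (f : 'rV[R]_n -> R), 0 < d -> X f ->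
       (omegaK K d (T f) <= omegaK K d f)%E)
  /\
  (forall (d : R) (f : 'rV[R]_n -> R) (r s : R), 0 < d -> X f ->
     0 < r -> r <= s ->
     dilate r unit_ball `<=` K -> K `<=` dilate s unit_ball ->
     (omega (d * r) (T f) <= omega (d * s) f)%E).
Proof.
have [cK convK K0] := hK.
split=> [symK d f d0 Xf|d f r s d0 Xf r0 rs rK Ks].
  apply: (smoothing_modulus_le (W := odilate d K) hX hT hK hTK _ convK K0 symK d0 Xf).
  - by [].
  - by move=> u; exact: gauge_odilate.
  - by [].
  - by move=> u; exact: odilateN.
  - have clK : closed K by apply: compact_closed cK; exact: norm_hausdorff.
    apply: closed_convex_boundary => //; first exact: interior_subset.
    by move=> u; exact: gauge_le_dilate.
have s0 : 0 < s := lt_le_trans r0 rs.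
have symB (t : R) : 0 < t -> o_symmetric (dilate t unit_ball : set 'rV[R]_n).
  move=> t0; apply: o_symmetric_of_opp => u /(ball_dilateP _ t0) ut.
  by apply/(ball_dilateP _ t0); rewrite enormN.
have convB (t : R) : convex_set (dilate t unit_ball : set 'rV[R]_n).
  exact/convex_dilate/convex_unit_ball.
(* [L] is the ball of radius [s]; [W] comes from the inner ball, which is symmetric. *)
apply: (smoothing_modulus_le (W := odilate d (dilate r unit_ball)) hX hT hK hTK Ks
  (convB s) (interior_ball s0) (symB s s0) d0 Xf).
- move=> u [l /andP[l0 ld] [w /(ball_dilateP _ s0) ws <-]].
  rewrite enormZ ?(ltW l0)//.
  exact: ler_pM (ltW l0) (enorm_ge0 _) (ltW ld) ws.
- exact: odilateS.
- by move=> u; apply: odilateN; exact: symB.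
- apply: closed_convex_boundary => //.
  + rewrite (_ : dilate r unit_ball = eball 0 r); first exact: closed_eball.
    apply/seteqP; split => u; rewrite /eball/= subr0 => ur;
      by apply/(ball_dilateP _ r0).
  + exact: interior_subset (interior_ball r0).
  + move=> u ur; rewrite dilate_dilate.
    by apply/ball_dilateP => //; exact: mulr_gt0.
Qed.
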